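(* Let $T>0$, let $m\ge 1$, let $\alpha_0>\alpha_1>\cdots>\alpha_m\ge 0$ be real numbers, let $n_0$ be the integer with $n_0-1<\alpha_0\le n_0$, and let $\gamma=n_0-\alpha_0$ with $0<\gamma<1$. Consider the equation $${}^cD_{0+}^{\alpha_0}y(t)=-\sum_{i=1}^m a_i(t)\,{}^cD_{0+}^{\alpha_i}y(t),\qquad 0<t<T.\tag{E}$$ Assume that $a_i\in C^1_\gamma[0,T]$ for $i=1,\dots,m$ and that $H_{n_0-1}:=\{i\in\{1,\dots,m\}:0\le\alpha_i\le n_0-1\}=\emptyset$. Then (E) has a unique canonical fundamental system $\{y_j: j=0,1,\dots,n_0-1\}$ of solutions in $C_\gamma^{n_0}[0,T]$, and it is given by $$y_j(t)=\Phi_{j+1}(t)=\frac{t^j}{j!},\qquad j=0,1,\dots,n_0-1.$$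
   Context: All functions are real valued. For $0\le\gamma<1$, $C_\gamma[0,T]$ is the space of functions $f$ on $(0,T]$ such that $t\mapsto t^\gamma f(t)$ belongs to $C[0,T]$ (i.e. extends continuously to $[0,T]$). For $n\in\mathbb N$, $C^n_\gamma[0,T]$ is the space of functions $f$ that are $n-1$ times continuously differentiable on $[0,T]$ and have an $n$-th derivative $f^{(n)}\in C_\gamma[0,T]$. Riemann–Liouville integral: $I_{0+}^\alpha f(t)=\frac1{\Gamma(\alpha)}\int_0^t(t-\tau)^{\alpha-1}f(\tau)\,d\tau$ for $\alpha>0$, and $I^0_{0+}f=f$. Riemann–Liouville derivative: for $n-1<\alpha\le n$, $D_{0+}^\alpha f(t)=\frac{d^n}{dt^n}I_{0+}^{n-\alpha}f(t)$ for $t>0$. Caputo derivative: for $n-1<\alpha\le n$, ${}^cD_{0+}^\alpha f(t)=D_{0+}^\alpha\big[f(t)-\sum_{k=0}^{n-1}\frac{f^{(k)}(0)}{k!}t^k\big]$. A canonical fundamental system of solutions of (E) is a system of functions $y_0,\dots,y_{n_0-1}$, each satisfying (E), with $D^ky_j(t)|_{t=+0}=1$ if $k=j$ and $=0$ if $k\ne j$, for $k,j=0,1,\dots,n_0-1$, where $D^k=d^k/dt^k$. *)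

(* Defs.v *)
(* MathComp-Analysis, over an abstract [R : realType]. *)
From HB Require Import structures.
From mathcomp Require Import all_boot all_order all_algebra.
From mathcomp Require Import all_classical all_reals all_analysis.
Set Implicit Arguments.
Unset Strict Implicit.
Unset Printing Implicit Defensive.
Import Order.TTheory GRing.Theory Num.Theory.
Import numFieldNormedType.Exports.
Local Open Scope classical_set_scope.
Local Open Scope ring_scope.

(* Functions on [0, T] or ]0, T] are represented by total functions R -> R whose
   values outside the interval are irrelevant. Derivatives of such functions are
   therefore taken relative to the interval (one-sided at its endpoints): a
   two-sided derivative at 0 or T would depend on the outside values. *)

Definition diff_quot {R : realType} (f : R -> R) (x y : R) : R :=
  (f y - f x) / (y - x).

Definition derivable_in {R : realType} (A : set R) (f : R -> R) (x : R) : Prop :=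
  cvg (diff_quot f x y @[y --> within A x^']).

Definition derive_in {R : realType} (A : set R) (f : R -> R) (x : R) : R :=
  lim (diff_quot f x y @[y --> within A x^']).

Definition derivn_in {R : realType} (A : set R) (k : nat) (f : R -> R) : R -> R :=
  iter k (derive_in A) f.

(* C_gamma[0, T] *)
Definition Cgamma {R : realType} (T gamma : R) : set (R -> R) :=
  [set f | exists g : R -> R, {within `[0, T], continuous g} /\
     forall t : R, 0 < t <= T -> g t = t `^ gamma * f t].

(* C^n_gamma[0, T]: the derivatives of order < n exist and are continuous on the
   closed interval, the one of order n is only required to exist on ]0, T]. *)
Definition Cgamman {R : realType} (T gamma : R) (n : nat) : set (R -> R) :=
  [set f | [/\
     forall k, (k.+1 < n)%N -> forall x : R, 0 <= x <= T ->
       derivable_in `[0, T] (derivn_in `[0, T] k f) x,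
     forall k, (k < n)%N -> {within `[0, T], continuous (derivn_in `[0, T] k f)},
     forall k, k.+1 = n -> forall x : R, 0 < x <= T ->
       derivable_in `[0, T] (derivn_in `[0, T] k f) x
   & Cgamma T gamma (derivn_in `[0, T] n f)]].

Definition Gamma {R : realType} (a : R) : R :=
  \int[lebesgue_measure]_(x in `]0%R, +oo[) (x `^ (a - 1) * expR (- x)).

Definition RLint {R : realType} (alpha : R) (f : R -> R) (t : R) : R :=
  if alpha == 0 then f t
  else (Gamma alpha)^-1 *
       \int[lebesgue_measure]_(tau in `]0%R, t[) ((t - tau) `^ (alpha - 1) * f tau).

(* For alpha >= 0, the n such that n - 1 < alpha <= n. *)
Definition order_of {R : realType} (alpha : R) : nat := `|Num.ceil alpha|%N.

Definition RLderiv {R : realType} (alpha : R) (f : R -> R) (t : R) : R :=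
  (RLint ((order_of alpha)%:R - alpha) f)^`(order_of alpha)%classic t.

(* Existence on ]0, T[ of all the successive derivatives taken in RLderiv. *)
Definition RLderivable {R : realType} (T alpha : R) (f : R -> R) : Prop :=
  forall k, (k < order_of alpha)%N -> forall t : R, 0 < t < T ->
    derivable ((RLint ((order_of alpha)%:R - alpha) f)^`(k)%classic) t 1.

Definition sub_taylor {R : realType} (T : R) (n : nat) (f : R -> R) (t : R) : R :=
  f t - \sum_(k < n) derivn_in `[0, T] k f 0 / (k`!)%:R * t ^+ k.

Definition caputo {R : realType} (T alpha : R) (f : R -> R) : R -> R :=
  RLderiv alpha (sub_taylor T (order_of alpha) f).

Definition caputo_derivable {R : realType} (T alpha : R) (f : R -> R) : Prop :=
  RLderivable T alpha (sub_taylor T (order_of alpha) f).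

(* The equation has order alpha 0; the lower orders alpha i and the coefficients
   a i are indexed by 1 <= i <= m, other indices being irrelevant. Since
   derivatives are total functions, a solution is explicitly required to have all
   the fractional derivatives occurring in the equation. *)
Definition is_solution {R : realType} (T : R) (m : nat) (alpha : nat -> R)
    (a : nat -> R -> R) (y : R -> R) : Prop :=
  (forall i, (i <= m)%N -> caputo_derivable T (alpha i) y) /\
  (forall t : R, 0 < t < T ->
     caputo T (alpha 0%N) y t =
       - \sum_(1 <= i < m.+1) a i t * caputo T (alpha i) y t).

Definition canonical_fundamental_system {R : realType} (T : R) (m n0 : nat)
    (alpha : nat -> R) (a : nat -> R -> R) (y : 'I_n0 -> R -> R) : Prop :=
  (forall j, is_solution T m alpha a (y j)) /\
  (forall k j : 'I_n0,
     derivn_in `[0, T] k (y j) t @[t --> 0^'+] --> ((k == j)%:R : R)).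

Definition Hset {R : realType} (m : nat) (alpha : nat -> R) (r : R) : set nat :=
  [set i | (1 <= i <= m)%N /\ 0 <= alpha i <= r].

(* Main.v *)
(* Emptiness of H forces n0 - 1 < alpha_i, so all the Caputo derivatives in (E)
   are of the form d^n0/dt^n0 I^(n0 - alpha_i) g with the same g, the function y
   minus its Taylor polynomial of degree n0 - 1; this g vanishes for y = t^j/j!.
   For uniqueness let G = g^(n0 - 1). The first n0 - 1 derivatives go under the
   integral, and V = I^gamma G is Lipschitz because G' = O(t^-gamma). As
   I^(n0 - alpha_i) G is proportional to I^(alpha_0 - alpha_i) V, equation (E)
   reads V' = sum_i b_i (I^(d_i) V)' with bounded b_i and d_i > 0. If V is
   N-Lipschitz and vanishes before p, then I^d V is N (S - p)^d / d-Lipschitz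
   before S, so (E) halves the Lipschitz constant of V on a short interval, and
   V = 0 step by step. Applying I^(1 - gamma) gives I^1 G = 0, whence G = 0.
   Only proportionality is needed in the semigroup law, so that the relation
   between the Beta and Gamma functions plays no role. *)
Require Import Defs.
From mathcomp Require Import all_boot all_order all_algebra.
From mathcomp Require Import all_classical all_reals all_analysis.
From mathcomp Require Import measurable_realfun ring lra.
Import Order.TTheory GRing.Theory Num.Theory.
Import numFieldNormedType.Exports.
Local Open Scope classical_set_scope.
Local Open Scope ring_scope.
Set Implicit Arguments.
Unset Strict Implicit.
Unset Printing Implicit Defensive.

(** * Affine substitution *)
Section affine_substitution.
Context {R : realType}.
Notation mu := (@lebesgue_measure R).

Lemma measurable_affine (c d : R) : measurable_fun setT (fun x : R => c * x + d).
Proof. by apply: measurable_funD => //; exact: measurable_funM. Qed.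

(** The right-hand side is a measure in [A], so by uniqueness of Lebesgue measure it is enough to
    compare half-open intervals. A negative [c] swaps the open and the closed end, which leaves the
    length unchanged. *)
Lemma lebesgue_measure_affine (c d : R) (A : set R) : c != 0 -> measurable A ->
  mu A = (`|c|%:E * mu ((fun x => c * x + d)%R @^-1` A))%E.
Proof.
move=> c0 mA; pose f : measurableTypeR R -> measurableTypeR R := fun x => c * x + d.
have mf : measurable_fun setT f by exact: measurable_affine.
pose k : {nonneg R} := NngNum (normr_ge0 c).
pose nu : {measure set (measurableTypeR R) -> \bar R} :=
  mscale k (pushforward mu f : {measure set (measurableTypeR R) -> \bar R}).
have -> : (`|c|%:E * mu (f @^-1` A) = nu mf A)%E by [].
apply: lebesgue_measure_unique => // _ [[a b] /= ab <-] {A mA}.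
rewrite /nu /mscale/= /pushforward lebesgue_measure_itv/= lte_fin.
case: (ltP a b) => [ab'|ba]; last first.
  rewrite (_ : `]a, b] = set0)%classic ?preimage_set0 ?measure0 ?mule0//.
  by rewrite set_itv_ge// bnd_simp -leNgt.
case: (ltgtP 0 c) c0 => // c0 _.
- rewrite (_ : _ @^-1` _ = `](a - d) / c, (b - d) / c]%classic); last first.
    apply/seteqP; split=> x /=; rewrite !in_itv/= ltr_pdivrMr// ler_pdivlMr//;
      by rewrite ltrBlDr lerBrDr (mulrC x).
  rewrite lebesgue_measure_itv/= lte_fin ltr_pM2r ?invr_gt0// ltrD2r ab'.
  rewrite -!EFinB -EFinM gtr0_norm//; congr EFin.
  by field; rewrite gt_eqF.
- rewrite (_ : _ @^-1` _ = `[(b - d) / c, (a - d) / c[%classic); last first.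
    apply/seteqP; split=> x /=; rewrite !in_itv/= ler_ndivrMr// ltr_ndivlMr//;
      by rewrite ltrBlDr lerBrDr (mulrC x) andbC.
  rewrite lebesgue_measure_itv/= lte_fin ltr_nM2r ?invr_lt0// ltrD2r ab'.
  rewrite -!EFinB -EFinM ltr0_norm//; congr EFin.
  by field; rewrite lt_eqF.
Qed.

Lemma ge0_integral_affine (c d : R) (f : R -> \bar R) : c != 0 ->
  measurable_fun setT f -> (forall x, 0 <= f x)%E ->
  (\int[mu]_x f x = `|c|%:E * \int[mu]_x f (c * x + d)%R)%E.
Proof.
move=> c0 mf f0; pose g : measurableTypeR R -> measurableTypeR R := fun x => c * x + d.
have mg : measurable_fun setT g by exact: measurable_affine.
pose k : {nonneg R} := NngNum (normr_ge0 c).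
pose nu : {measure set (measurableTypeR R) -> \bar R} :=
  mscale k (pushforward mu g : {measure set (measurableTypeR R) -> \bar R}).
rewrite (@eq_measure_integral _ _ _ _ (nu mg)); last first.
  by move=> A mA _; exact: lebesgue_measure_affine.
rewrite ge0_integral_mscale//; congr (_ * _)%E.
rewrite ge0_integral_pushforward//.
Qed.

(** The nonnegative substitution with slope -1 is applied to the positive and the negative part
    separately. *)
Lemma integral_reflect (t : R) (f : R -> \bar R) : measurable_fun setT f ->
  (\int[mu]_x f x = \int[mu]_x f (t - x)%R)%E.
Proof.
move=> mf; rewrite integralE [RHS]integralE.
rewrite (@ge0_integral_affine (-1) t (f^\+)%E)//; last exact: measurable_funepos.
rewrite (@ge0_integral_affine (-1) t (f^\-)%E)//; last exact: measurable_funeneg.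
rewrite normrN1 !mul1e; congr (_ - _)%E; apply: eq_integral => x _.
  by rewrite !funeposE mulN1r addrC.
by rewrite !funenegE mulN1r addrC.
Qed.

End affine_substitution.

(** * The kernel of fractional integration *)
Section kernel.
Context {R : realType}.
Notation mu := (@lebesgue_measure R).

(* The positivity test is not redundant: [u `^ r] is [1] for [u < 0]. *)
Definition RLker (b u : R) : R := if 0 < u then u `^ (b - 1) else 0.

Lemma RLker_ge0 b u : 0 <= RLker b u.
Proof. by rewrite /RLker; case: ifP => // _; exact: powR_ge0. Qed.

Lemma RLker_gt0 b u : 0 < u -> RLker b u = u `^ (b - 1).
Proof. by rewrite /RLker => ->. Qed.

Lemma RLker_le0 b u : u <= 0 -> RLker b u = 0.
Proof. by rewrite /RLker ltNge => ->. Qed.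

Lemma measurable_RLker b : measurable_fun setT (RLker b).
Proof.
apply: measurable_fun_ifT => //; exact: measurable_fun_ltr.
Qed.

Lemma RLkerM b c u : 0 < c -> RLker b (c * u) = c `^ (b - 1) * RLker b u.
Proof.
move=> c0; rewrite /RLker pmulr_rgt0//; case: ifPn => [u0|]; last by rewrite mulr0.
by rewrite powRM// ltW.
Qed.

Lemma continuous_powR_gt0 (b x : R) : 0 < x -> {for x, continuous (@powR R ^~ b)}.
Proof.
move=> x0; apply/differentiable_continuous/derivable1_diffP.
by have [] := @is_derive1_powR R b x x0.
Qed.

Lemma integral_powR_itv (b r S : R) : b != 0 -> 0 < r -> r < S ->
  (\int[mu]_(x in `[r, S]) (x `^ (b - 1))%:E = (S `^ b / b - r `^ b / b)%:E)%E.
Proof.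
move=> b0 r0 rS; rewrite EFinB.
have dF (x : R) : 0 < x -> is_derive x 1 (fun y => y `^ b / b) (x `^ (b - 1)).
  move=> x0; have := @is_derive1_powR R b x x0 => dx.
  rewrite (_ : (fun y : R => _) = (b^-1 *: (@powR R ^~ b))); last first.
    by apply/funext => y; rewrite fctE mulrC.
  have -> : x `^ (b - 1) = b^-1 *: (b * x `^ (b - 1)).
    by rewrite /GRing.scale/= mulKf.
  exact: is_deriveZ.
have cF (x : R) : 0 < x -> {for x, continuous (fun y : R => y `^ b / b)}.
  move=> x0; apply/differentiable_continuous/derivable1_diffP.
  by have [] := dF _ x0.
apply: (@continuous_FTC2 _ (fun x => x `^ (b - 1)) (fun y => y `^ b / b)) => //.
- apply: continuous_in_subspaceT => x; rewrite inE/= in_itv/= => /andP[rx _].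
  by apply: continuous_powR_gt0; exact: lt_le_trans rx.
- split.
  + move=> x; rewrite in_itv/= => /andP[rx _].
    by have [] := dF _ (lt_trans r0 rx).
  + by apply: cvg_at_right_filter; exact: cF.
  + by apply: cvg_at_left_filter; apply: cF; exact: lt_trans rS.
- move=> x; rewrite in_itv/= => /andP[rx _]; rewrite derive1E.
  by have [_ ->] := dF _ (lt_trans r0 rx).
Qed.

(** For [b < 1] the integrand is singular at 0, so the fundamental theorem is used on closed
    intervals away from 0 and monotone convergence passes to their union. *)
Lemma integral_powR_le (b S : R) : 0 < b -> 0 < S ->
  (\int[mu]_(x in `]0%R, S[) (x `^ (b - 1))%:E <= (S `^ b / b)%:E)%E.
Proof.
(* With [n.+2] the left end is strictly below [S] already for [n = 0], as [integral_powR_itv]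
   requires. *)
move=> b0 S0; pose F (n : nat) := `[S / n.+2%:R, S]%classic.
have mf (A : set R) : measurable A -> measurable_fun A (fun x : R => (x `^ (b - 1))%:E).
  by move=> mA; apply/measurable_EFinP; apply: measurable_funTS; exact: measurable_powR.
have f0 (x : R) : (0 <= (x `^ (b - 1))%:E)%E by rewrite lee_fin powR_ge0.
have bF : `]0, S[ `<=` \bigcup_n F n.
  move=> x /=; rewrite in_itv/= => /andP[x0 xS].
  exists (Num.truncn (S / x)) => //; rewrite /F/= in_itv/= (ltW xS) andbT.
  rewrite ler_pdivrMr// mulrC -ler_pdivrMr//.
  rewrite ltW// (lt_trans (truncnS_gt _))// ltr_nat//.
have mU : measurable (\bigcup_n F n) by apply: bigcup_measurable => n _; exact: measurable_itv.
apply: (@le_trans _ _ (\int[mu]_(x in \bigcup_n F n) (x `^ (b - 1))%:E)%E).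
  by apply: ge0_subset_integral => //; exact: mf.
have cvgF : (\int[mu]_(x in F i) (x `^ (b - 1))%:E)%E @[i --> \oo] -->
    (\int[mu]_(x in \bigcup_i F i) (x `^ (b - 1))%:E)%E.
  apply: ge0_nondecreasing_set_cvg_integral => //.
  - move=> m n mn; apply/subsetPset => x; rewrite /F/= !in_itv/= => /andP[h ->].
    rewrite andbT (le_trans _ h)// ler_pM2l// lef_pV2 ?posrE// ler_nat//.
  - by move=> n; exact: measurable_itv.
  - by move=> n; apply: mf; exact: measurable_itv.
rewrite -(cvg_lim _ cvgF)//; apply: lime_le; first exact: cvgP cvgF.
apply: nearW => n; rewrite integral_powR_itv ?lee_fin ?gt_eqF// ?divr_gt0//.
  by rewrite gerBl divr_ge0 ?powR_ge0// ltW.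
rewrite ltr_pdivrMr// ltr_pMr// (_ : 1 = 1%:R)// ltr_nat//.
Qed.

Lemma integrable_RLker (b S : R) : 0 < b -> 
  mu.-integrable `]0, S[ (EFin \o RLker b).
Proof.
move=> b0; apply/integrableP; split.
  by apply/measurable_EFinP; apply: measurable_funTS; exact: measurable_RLker.
have [S0|S0] := leP S 0.
  by rewrite set_itv_ge ?integral_set0// bnd_simp -leNgt.
apply: le_lt_trans _ (ltry (S `^ b / b)).
apply: le_trans _ (integral_powR_le b0 S0).
rewrite le_eqVlt; apply/orP; left; apply/eqP.
apply: eq_integral => x; rewrite inE/= in_itv/= => /andP[x0 _].
by rewrite /= RLker_gt0// ger0_norm// powR_ge0.
Qed.

Lemma Rintegral_RLker_le (b S : R) : 0 < b -> 0 < S ->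
  \int[mu]_(x in `]0, S[) RLker b x <= S `^ b / b.
Proof.
move=> b0 S0; rewrite -lee_fin fineK; last first.
  by apply: integrable_fin_num => //; exact: integrable_RLker.
apply: le_trans _ (integral_powR_le b0 S0).
rewrite le_eqVlt; apply/orP; left; apply/eqP; apply: eq_integral => x.
by rewrite inE/= in_itv/= => /andP[x0 _]; rewrite RLker_gt0.
Qed.

End kernel.

(** * The Beta integral and the convolution of two kernels *)

Section beta.
Context {R : realType}.
Notation mu := (@lebesgue_measure R).

Lemma integrable_reflect (t : R) (f : R -> R) :
  mu.-integrable setT (EFin \o f) ->
  mu.-integrable setT (EFin \o (fun x => f (t - x))).
Proof.
move=> /integrableP[/measurable_EFinP mf fi]; apply/integrableP; split.
  apply/measurable_EFinP; apply: (measurableT_comp mf).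
  exact: measurable_funB.
suff <- : (\int[mu]_x `|(EFin \o f) x| =
    \int[mu]_x `|(EFin \o (fun x => f (t - x)%R)) x|)%E by [].
apply: (@integral_reflect R t (fun x => `|(EFin \o f) x|)%E).
apply: measurableT_comp => //; exact/measurable_EFinP.
Qed.

Lemma integrable_RLkerT (b S : R) : 0 < b ->
  mu.-integrable setT (EFin \o (RLker b \_ `]0, S[)).
Proof.
move=> b0; have := integrable_RLker S b0.
by rewrite integrable_mkcond// -restrict_EFin.
Qed.

(** Euler's Beta function: the positivity test inside [RLker] confines the integrand to ]0, 1[. *)
Definition RLbeta (a b : R) : R := \int[mu]_x (RLker a (1 - x) * RLker b x).

(** The sum covers both signs of the exponent: an increasing power is at most 1, a decreasing one is
    at most its value at 1/2. *)
Lemma powR_half_le (a y : R) : 2^-1 <= y -> y <= 1 ->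
  y `^ (a - 1) <= 1 + 2^-1 `^ (a - 1).
Proof.
move=> y2 y1; have y0 : 0 < y by apply: lt_le_trans y2; rewrite invr_gt0.
have [a1|a1] := leP 1 a.
  rewrite -[leLHS]addr0 lerD ?powR_ge0//.
  have {2}<- : (1 : R) `^ (a - 1) = 1 by rewrite powR1.
  by apply: ge0_ler_powR; rewrite ?nnegrE ?subr_ge0// ltW.
rewrite -[leLHS]add0r lerD//.
have e : a - 1 = - (1 - a) by rewrite opprB.
rewrite e !powRN lef_pV2 ?posrE ?powR_gt0 ?invr_gt0//.
apply: ge0_ler_powR; rewrite ?nnegrE ?subr_ge0//; exact: ltW.
Qed.

Lemma measurable_RLker_conv (a b t : R) :
  measurable_fun setT (fun x : R => RLker a (t - x) * RLker b x).
Proof.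
apply: measurable_funM; last exact: measurable_RLker.
apply: (measurableT_comp (measurable_RLker a)); exact: measurable_funB.
Qed.

(** The two singularities are at opposite ends. Left of 1/2 the factor [RLker a (1 - x)] is bounded
    by [C a], right of 1/2 the factor [RLker b x] is bounded by [C b]; the other factor is
    integrable, and [h] adds both majorants. *)
Lemma integrable_RLbeta (a b : R) : 0 < a -> 0 < b ->
  mu.-integrable setT (EFin \o (fun x => RLker a (1 - x) * RLker b x)).
Proof.
move=> a0 b0; pose C c := 1 + 2^-1 `^ (c - 1) : R.
have C0 c : 0 <= C c by rewrite addr_ge0// powR_ge0.
pose h x := C a * (RLker b \_ `]0, 1[) x + C b * (RLker a \_ `]0, 1[) (1 - x).
have ih : mu.-integrable setT (EFin \o h).
  have i1 := integrableZl measurableT (C a) (integrable_RLkerT 1 b0).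
  have i2 := integrableZl measurableT (C b)
    (integrable_reflect 1 (integrable_RLkerT 1 a0)).
  exact: integrableD i1 i2.
apply: le_integrable ih => //.
- by apply/measurable_EFinP; exact: measurable_RLker_conv.
- move=> x _; rewrite /= lee_fin [leRHS]ger0_norm; last first.
    by rewrite addr_ge0// mulr_ge0// patchE; case: ifP => // _; exact: RLker_ge0.
  rewrite ger0_norm ?mulr_ge0 ?RLker_ge0// /h.
  have [x0|x0] := leP x 0.
    rewrite [RLker b x]RLker_le0// mulr0 addr_ge0// mulr_ge0// patchE;
    by case: ifP => // _; exact: RLker_ge0.
  have [x1|x1] := leP 1 x.
    rewrite [RLker a (1 - x)]RLker_le0 ?subr_le0// mul0r addr_ge0// mulr_ge0// patchE;
    by case: ifP => // _; exact: RLker_ge0.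
  rewrite !patchE !mem_setE !in_itv/= x0 x1 subr_gt0 x1 gtrBl x0/=.
  have [x2|x2] := leP x 2^-1.
    rewrite -[leLHS]addr0 lerD ?mulr_ge0 ?RLker_ge0//.
    rewrite ler_wpM2r ?RLker_ge0// RLker_gt0 ?subr_gt0// powR_half_le//.
      by lra.
    by lra.
  rewrite -[leLHS]add0r lerD ?mulr_ge0 ?RLker_ge0//.
  rewrite mulrC ler_wpM2r ?RLker_ge0// RLker_gt0// powR_half_le// ltW//.
Qed.

(** Both exponents are nonpositive, so both factors are at least 1 on ]0, 1[. This lower bound is
    what later permits division by [RLbeta]. *)
Lemma RLbeta_ge1 (a b : R) : 0 < a <= 1 -> 0 < b <= 1 -> 1 <= RLbeta a b.
Proof.
move=> /andP[a0 a1] /andP[b0 b1].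
have ib := integrable_RLbeta a0 b0.
rewrite -lee_fin fineK; last by apply: integrable_fin_num.
have -> : 1%:E = (\int[mu]_x (\1_(`]0%R, 1%R[%classic : set R) x)%:E)%E.
  by rewrite integral_indic//= setIT lebesgue_measure_itv/= lte_fin ltr01 oppr0 adde0.
apply: ge0_le_integral => //.
- by apply/measurable_EFinP; exact: measurable_indic.
- by apply/measurable_EFinP; exact: measurable_RLker_conv.
- move=> x _; rewrite lee_fin indicE mem_setE in_itv/=.
  case: (ltP 0 x) => x0/=; last by rewrite mulr_ge0// RLker_ge0.
  case: (ltP x 1) => x1/=; last by rewrite mulr_ge0// RLker_ge0.
  rewrite !RLker_gt0 ?subr_gt0//.
  have ge1 (c y : R) : c <= 1 -> 0 < y -> y <= 1 -> 1 <= y `^ (c - 1).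
    by move=> c1 y0 y1; rewrite -[leLHS](powRr0 y); apply: ger_powR;
      rewrite ?y0 ?subr_le0.
  by rewrite -[leLHS]mul1r ler_pM// ge1 ?subr_gt0// ?gerBl ltW.
Qed.

(** For [t > 0] the scaling [x := t * x] reduces to the Beta integral on ]0, 1[. The Jacobian and
    the homogeneity of the kernels contribute the exponents 1, [a - 1] and [b - 1], which add up to
    [a + b - 1]. *)
Lemma integral_RLker_conv (a b t : R) : 0 < a -> 0 < b ->
  (\int[mu]_x (RLker a (t - x) * RLker b x)%:E =
   (RLbeta a b * RLker (a + b) t)%:E)%E.
Proof.
move=> a0 b0; have [t0|t0] := leP t 0.
  rewrite [RLker _ t]RLker_le0// mulr0 integral0_eq// => x _.
  have [x0|x0] := leP x 0; first by rewrite [RLker b x]RLker_le0// mulr0.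
  by rewrite RLker_le0 ?mul0r// subr_le0 (le_trans t0)// ltW.
have ib := integrable_RLbeta a0 b0.
rewrite (@ge0_integral_affine R t 0) ?gt_eqF//; last 2 first.
- by apply/measurable_EFinP; exact: measurable_RLker_conv.
- by move=> x; rewrite lee_fin mulr_ge0// RLker_ge0.
have -> : (\int[mu]_x (RLker a (t - (t * x + 0)) * RLker b (t * x + 0))%:E =
    \int[mu]_x ((t `^ (a - 1) * t `^ (b - 1))%:E * (RLker a (1 - x) * RLker b x)%:E))%E.
  apply: eq_integral => x _.
  have tx : t - (t * x + 0) = t * (1 - x) by ring.
  by rewrite tx addr0 !RLkerM//= -EFinM; congr EFin; ring.
rewrite integralZl// -[X in (_ * (_ * X))%E]fineK; last exact: integrable_fin_num.
rewrite -!EFinM; congr EFin; rewrite gtr0_norm// mulrA mulrC; congr (_ * _).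
rewrite RLker_gt0// -powRD ?(gt_eqF t0) ?implybT//.
rewrite -{1}(powRr1 (ltW t0)) -powRD ?(gt_eqF t0) ?implybT//.
by congr (_ `^ _); ring.
Qed.

End beta.

(** * Fractional integrals as convolutions *)
Section convolution.
Context {R : realType}.
Notation mu := (@lebesgue_measure R).

(** Vanishing up to 0 turns an integral over ]0, t[ into a convolution over the whole line. *)
Definition causal (F : R -> R) := forall x, x <= 0 -> F x = 0.

(** The Riemann-Liouville integral without the factor [(Gamma b)^-1]. The variable is reflected so
    that [t] enters only through [F], which makes differentiation under the integral possible. *)
Definition RLconv (b : R) (F : R -> R) (t : R) : R :=
  \int[mu]_u (RLker b u * F (t - u)).

Lemma continuous_itv_bounded (F : R -> R) (a b : R) :
  {within `[a, b], continuous F} ->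
  exists2 M, 0 <= M & forall x, a <= x <= b -> `|F x| <= M.
Proof.
move=> cF; have [ab|ba] := leP a b; last first.
  exists 0 => // x /andP[ax xb]; by have := le_lt_trans (le_trans ax xb) ba; rewrite ltxx.
have [c1 _ h1] := EVT_max ab cF; have [c2 _ h2] := EVT_min ab cF.
exists (`|F c1| + `|F c2|); first by rewrite addr_ge0.
move=> x xab; have xin : x \in `[a, b] by rewrite in_itv.
have := h1 _ xin; have := h2 _ xin => l1 l2.
rewrite ler_norml; apply/andP; split.
  rewrite (le_trans _ l1)// opprD (le_trans _ (lerNnormlW (lexx `|F c2|)))//.
  by rewrite gerDr oppr_le0.
by rewrite (le_trans l2)// (le_trans (ler_norm _))// lerDl.
Qed.

Lemma causal_bounded (F : R -> R) (t : R) : continuous F -> causal F ->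
  exists2 M, 0 <= M & forall x, x <= t -> `|F x| <= M.
Proof.
move=> cF F0.
have [M M0 h] := @continuous_itv_bounded F 0 t (continuous_subspaceT cF).
exists M => // x xt; have [x0|x0] := leP x 0; first by rewrite F0// normr0.
by apply: h; rewrite (ltW x0).
Qed.

Lemma measurable_shift (F : R -> R) (t : R) : measurable_fun setT F ->
  measurable_fun setT (fun u : R => F (t - u)).
Proof. by move=> mF; apply: (measurableT_comp mF); exact: measurable_funB. Qed.

Lemma integrable_RLconv (b : R) (F : R -> R) (t : R) : 0 < b ->
  continuous F -> causal F ->
  mu.-integrable setT (EFin \o (fun u => RLker b u * F (t - u))).
Proof.
move=> b0 cF F0; have [M M0 FM] := causal_bounded t cF F0.
have ih := integrableZl measurableT M (integrable_RLkerT (Num.max t 0 + 1) b0).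
apply: le_integrable ih => //.
  apply/measurable_EFinP; apply: measurable_funM; first exact: measurable_RLker.
  by apply: measurable_shift; exact: continuous_measurable_fun.
move=> u _; rewrite /= lee_fin patchE mem_setE in_itv/=.
have [u0|u0] := leP u 0; first by rewrite RLker_le0// mul0r normr0.
have [ut|ut]/= := ltP u (Num.max t 0 + 1).
  rewrite !normrM mulrC ler_wpM2r// (ger0_norm M0) FM// gerBl; exact: ltW.
rewrite F0 ?mulr0// subr_le0 (le_trans _ ut)//.
by rewrite (@le_trans _ _ (Num.max t 0)) ?le_max ?lexx// lerDl.
Qed.

(** For [u >= S] the argument [t - u] is at most [p]. The range ]0, S[ is the same for all
    admissible [t], so values at different points can be compared under one integral. *)
Lemma RLconv_itv (b p : R) (F : R -> R) (t S : R) :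
  (forall x, x <= p -> F x = 0) -> t <= p + S ->
  RLconv b F t = \int[mu]_(u in `]0, S[) (RLker b u * F (t - u)).
Proof.
move=> F0 tS; rewrite [RHS]Rintegral_mkcond; apply: eq_Rintegral => u _.
rewrite patchE mem_setE in_itv/=.
have [u0|u0]/= := ltP 0 u; last by rewrite RLker_le0// mul0r.
have [uS|uS]//= := ltP u S.
by rewrite F0 ?mulr0// lerBlDr (le_trans tS)// lerD2l.
Qed.

Lemma RLconvE (b : R) (F : R -> R) (t : R) : continuous F -> causal F ->
  RLconv b F t = \int[mu]_(s in `]0, t[) ((t - s) `^ (b - 1) * F s).
Proof.
move=> cF F0; rewrite [RHS]Rintegral_mkcond /RLconv /Rintegral; congr fine.
rewrite (@integral_reflect R t); last first.
  apply/measurable_EFinP; apply: measurable_funM; first exact: measurable_RLker.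
  by apply: measurable_shift; exact: continuous_measurable_fun.
apply: eq_integral => s _; congr EFin; rewrite subKr patchE mem_setE in_itv/=.
have [s0|s0]/= := ltP 0 s; last by rewrite F0// mulr0.
have [st|st]/= := ltP s t; first by rewrite RLker_gt0// subr_gt0.
by rewrite RLker_le0 ?mul0r// subr_le0.
Qed.

Lemma RLconv_causal (b : R) (F : R -> R) : causal F -> causal (RLconv b F).
Proof.
move=> F0 x x0; rewrite (@RLconv_itv b 0 F x 0)// ?addr0// set_itv_ge ?Rintegral_set0//.
by rewrite bnd_simp -leNgt.
Qed.

Lemma RLbeta_ge0 (a b : R) : 0 <= RLbeta a b.
Proof. by apply: Rintegral_ge0 => x _; rewrite mulr_ge0// RLker_ge0. Qed.

Lemma integrable_RLker_conv (a b t : R) : 0 < a -> 0 < b ->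
  mu.-integrable setT (EFin \o (fun x => RLker a (t - x) * RLker b x)).
Proof.
move=> a0 b0; apply/integrableP; split.
  by apply/measurable_EFinP; exact: measurable_RLker_conv.
apply: le_lt_trans _ (ltry (RLbeta a b * RLker (a + b) t)).
rewrite -integral_RLker_conv// le_eqVlt; apply/orP; left; apply/eqP.
apply: eq_integral => x _.
by rewrite /= normrM !ger0_norm// RLker_ge0.
Qed.

Lemma RLconv_EFin (b : R) (F : R -> R) (t : R) : 0 < b ->
  continuous F -> causal F ->
  ((RLconv b F t)%:E = \int[mu]_s (RLker b (t - s) * F s)%:E)%E.
Proof.
move=> b0 cF F0; rewrite fineK; last first.
  by apply: integrable_fin_num => //; exact: integrable_RLconv.
rewrite (@integral_reflect R t); last first.
  apply/measurable_EFinP; apply: measurable_funM.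
    by apply: measurable_shift; exact: measurable_RLker.
  exact: continuous_measurable_fun.
by apply: eq_integral => s _; rewrite subKr.
Qed.

(** Fubini: with [s] fixed, the inner integral over [u] is a convolution of two kernels and equals a
    multiple of [RLker (a + b) (t - s)]. *)
Lemma RLconv_semigroup (a b : R) (G : R -> R) (t : R) : 0 < a -> 0 < b ->
  continuous G -> causal G ->
  RLconv b (RLconv a G) t = RLbeta a b * RLconv (a + b) G t.
Proof.
move=> a0 b0 cG G0.
have mG : measurable_fun setT G by exact: continuous_measurable_fun.
pose f (z : measurableTypeR R * measurableTypeR R) : \bar R :=
  (RLker b z.1 * RLker a (t - z.1 - z.2) * G z.2)%:E.
have mf : measurable_fun setT f.
  apply/measurable_EFinP; apply: measurable_funM.
    apply: measurable_funM.
      by apply: (measurableT_comp (measurable_RLker b)); exact: measurable_fst.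
    apply: (measurableT_comp (measurable_RLker a)).
    by do 2! apply: measurable_funB => //.
  by apply: (measurableT_comp mG); exact: measurable_snd.
have intu (H : R -> R) s : (\int[mu]_u (RLker b u * RLker a (t - u - s) * `|H s|)%:E =
    (RLbeta a b * RLker (a + b) (t - s) * `|H s|)%:E)%E.
  rewrite EFinM -integral_RLker_conv// muleC -ge0_integralZl//.
  - apply: eq_integral => u _; rewrite -EFinM; congr EFin.
    by rewrite mulrC [RLker b u * _]mulrC addrAC.
  - by apply/measurable_EFinP; exact: measurable_RLker_conv.
  - by move=> u _; rewrite lee_fin mulr_ge0// RLker_ge0.
(* Tonelli in the same order: integrating the absolute value over [u] first leaves the kernel of
   order [a + b] against [|G|], which is integrable. *)
have intf : (mu \x mu)%E.-integrable setT f.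
  apply/(integrable21ltyP mu mu mf).
  have -> : (\int[mu]_s \int[mu]_u `|f (u, s)| =
      \int[mu]_s (RLbeta a b * RLker (a + b) (t - s) * `|G s|)%:E)%E.
    apply: eq_integral => s _; rewrite -intu; apply: eq_integral => u _.
    by rewrite /f/= !normrM !(ger0_norm (RLker_ge0 _ _)).
  have := integrableZl measurableT (RLbeta a b)
    (integrable_reflect t (integrable_RLconv t (addr_gt0 a0 b0) cG G0)).
  move=> /integrableP[_]; apply: le_lt_trans.
  apply: ge0_le_integral => //.
  - move=> s _; rewrite lee_fin !mulr_ge0// ?RLker_ge0//; exact: RLbeta_ge0.
  - apply/measurable_EFinP; apply: measurable_funM.
      apply: measurable_funM => //.
      by apply: measurable_shift; exact: measurable_RLker.
    exact: measurableT_comp.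
  - apply: measurableT_comp => //; apply/measurable_EFinP.
    apply: measurable_funM => //; apply: measurable_funM.
      by apply: measurable_shift; exact: measurable_RLker.
    exact: (measurable_shift t (measurable_shift t mG)).
  - move=> s _; rewrite /= lee_fin subKr !normrM mulrA ler_wpM2r//.
    by rewrite ler_pM ?RLbeta_ge0 ?RLker_ge0// ler_norm.
have -> : RLconv b (RLconv a G) t = fine (\int[mu]_u \int[mu]_s f (u, s))%E.
  congr fine; apply: eq_integral => u _; rewrite EFinM RLconv_EFin//.
  rewrite -integralZl//; last first.
    have := integrable_reflect (t - u) (integrable_RLconv (t - u) a0 cG G0).
    by under eq_fun do rewrite subKr.
  by apply: eq_integral => s _; rewrite -EFinM mulrA.
rewrite (Fubini intf).
have -> : (\int[mu]_s \int[mu]_u f (u, s) =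
    \int[mu]_s ((RLbeta a b)%:E * (RLker (a + b) (t - s) * G s)%:E))%E.
  apply: eq_integral => s _.
  rewrite -EFinM mulrA mulrC EFinM -integral_RLker_conv// -integralZl//; last first.
    exact: integrable_RLker_conv.
  apply: eq_integral => u _; rewrite -EFinM /f/=; congr EFin.
  by rewrite mulrC [RLker b u * _]mulrC addrAC.
rewrite integralZl//.
  by rewrite -RLconv_EFin// addr_gt0.
have := integrable_reflect t (integrable_RLconv t (addr_gt0 a0 b0) cG G0).
by under eq_fun do rewrite subKr.
Qed.

End convolution.

(** * Differentiability and Lipschitz bounds of fractional integrals *)

Section regularity.
Context {R : realType}.
Notation mu := (@lebesgue_measure R).

(** On the fixed range ]0, T[ the integrand has the derivative [RLker b y * f (x - y)], dominated by
    a multiple of the kernel. Causality of [F] removes the moving endpoint, hence any boundary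
    term. *)
Lemma is_derive_RLconv (b : R) (F f : R -> R) (T t : R) : 0 < b ->
  continuous F -> causal F -> continuous f -> causal f ->
  (forall x, x < T -> is_derive x 1 F (f x)) -> t < T ->
  is_derive t 1 (RLconv b F) (RLconv b f t).
Proof.
move=> b0 cF F0 cf f0 dF tT.
have RLconvT (H : R -> R) x : causal H -> x <= T ->
    RLconv b H x = \int[mu]_(u in `]0, T[) (RLker b u * H (x - u)).
  by move=> H0 xT; apply: (@RLconv_itv R b 0) => //; rewrite add0r.
pose h x y := RLker b y * F (x - y).
have tI : `]t - 1, T[%classic t by rewrite /= in_itv/= tT gtrBl ltr01.
have [M M0 fM] := causal_bounded T cf f0.
have mB : measurable (`]0, T[%classic : set (measurableTypeR R)) by [].
have intF x : mu.-integrable `]0, T[ (EFin \o h x).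
  apply: (@integrableS _ _ _ _ setT) => //; exact: integrable_RLconv.
have dh x y : x < T -> 0 < y -> is_derive x 1 (h ^~ y) (RLker b y * f (x - y)).
  move=> xT y0; have xyT : x - y < T by rewrite ltrBlDr (lt_trans xT)// ltrDl.
  have d1 := @is_derive1_comp R F (shift (- y)) x _ _ (dF _ xyT) (is_derive_shift x 1 (- y)).
  by have := is_deriveZ (RLker b y) d1; rewrite mulr1.
have dh1 x y : `]t - 1, T[%classic x -> `]0, T[%classic y -> derivable (h ^~ y) x 1.
  rewrite /= !in_itv/= => /andP[_ xT] /andP[y0 _].
  by have [] := dh _ _ xT y0.
have dhE x y : `]t - 1, T[%classic x -> `]0, T[%classic y ->
    partial1of2 h x y = RLker b y * f (x - y).
  rewrite /= !in_itv/= => /andP[_ xT] /andP[y0 _].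
  by rewrite /partial1of2 derive1E; have [_ ->] := dh _ _ xT y0.
have intG : mu.-integrable `]0, T[ (EFin \o (fun y => M * RLker b y)).
  have := integrableZl mB M (integrable_RLker T b0).
  by [].
have G0 y : 0 <= M * RLker b y by rewrite mulr_ge0// RLker_ge0.
have hG x y : `]t - 1, T[%classic x -> `]0, T[%classic y ->
    `|partial1of2 h x y| <= M * RLker b y.
  move=> xI yI; rewrite dhE// normrM (ger0_norm (RLker_ge0 _ _)) mulrC.
  move: xI yI; rewrite /= !in_itv/= => /andP[_ xT] /andP[y0 _].
  by rewrite ler_wpM2r ?RLker_ge0// fM// lerBlDr (le_trans (ltW xT))// lerDl ltW.
have dd := derivable_under_integral mB tI (fun x _ => intF x) dh1 G0 intG hG.
have de := differentiation_under_integral mB tI (fun x _ => intF x) dh1 G0 intG hG.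
apply: (@near_eq_is_derive _ _ _ (fun x => \int[mu]_(y in `]0, T[) h x y)).
  near=> x; rewrite RLconvT// ltW//; near: x; exact: lt_nbhsl.
split => //; rewrite -derive1E de RLconvT ?ltW//.
by apply: eq_Rintegral => y; rewrite inE => yI; rewrite dhE.
Unshelve. all: by end_near. Qed.

Lemma RLconvB (b : R) (F : R -> R) (t s : R) : 0 < b -> continuous F -> causal F ->
  RLconv b F t - RLconv b F s =
  \int[mu]_u (RLker b u * F (t - u) - RLker b u * F (s - u)).
Proof. by move=> b0 cF F0; rewrite RintegralB//; exact: integrable_RLconv. Qed.

Lemma RLconv_RLker (a b t : R) : 0 < a -> 0 < b ->
  RLconv b (RLker a) t = RLbeta a b * RLker (a + b) t.
Proof.
move=> a0 b0; rewrite /RLconv /Rintegral.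
have -> : (\int[mu]_u (RLker b u * RLker a (t - u))%:E =
    (RLbeta a b * RLker (a + b) t)%:E)%E; last by [].
rewrite -(integral_RLker_conv t a0 b0); apply: eq_integral => u _.
by rewrite mulrC.
Qed.

(* The bound on [G] is that of a primitive of an [O(t^-g)] function; its kernel
   is chosen so that [RLconv g (RLker (2 - g))] is proportional to the identity. *)
Lemma RLconv_lipschitz (g M : R) (G : R -> R) : 0 < g < 1 -> 0 <= M ->
  continuous G -> causal G ->
  (forall s t, s <= t -> `|G t - G s| <= M * (RLker (2 - g) t - RLker (2 - g) s)) ->
  forall s t, s <= t ->
  `|RLconv g G t - RLconv g G s| <= M * RLbeta (2 - g) g * (t - s).
Proof.
move=> /andP[g0 g1] M0 cG G0 GM s t st.
have g20 : 0 < 2 - g by lra.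
have iG r : mu.-integrable setT (EFin \o (fun u => RLker g u * G (r - u))).
  exact: integrable_RLconv.
have iK r : mu.-integrable setT (EFin \o (fun u => RLker g u * RLker (2 - g) (r - u))).
  have := integrable_RLker_conv r g20 g0.
  by under eq_fun do rewrite mulrC.
have iB := integrableB measurableT (iG t) (iG s).
have iKB := integrableZl measurableT M (integrableB measurableT (iK t) (iK s)).
rewrite RLconvB//.
apply: (le_trans (le_normr_Rintegral measurableT iB)).
have -> : M * RLbeta (2 - g) g * (t - s) = M * (RLbeta (2 - g) g * (t - s)) by rewrite mulrA.
apply: (@le_trans _ _ (M * (RLconv g (RLker (2 - g)) t - RLconv g (RLker (2 - g)) s))).
  rewrite -RintegralB// -RintegralZl//; last exact: (integrableB measurableT (iK t) (iK s)).
  apply: le_Rintegral => //.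
    by have := integrable_abse iB.
  move=> u _; rewrite -!mulrBr normrM (ger0_norm (RLker_ge0 _ _)) mulrCA.
  by rewrite ler_wpM2l ?RLker_ge0// GM// lerD2r.
rewrite ler_wpM2l// !RLconv_RLker// -mulrBr ler_wpM2l ?RLbeta_ge0//.
(* The kernel of order 2 is the positive part of its argument, which is 1-Lipschitz. *)
have -> : 2 - g + g = 2 by rewrite subrK.
rewrite /RLker (_ : 2 - 1 = 1 :> R); last by lra.
have [s0|s0] := ltP 0 s.
  by rewrite (lt_le_trans s0 st) !powRr1// ltW// (lt_le_trans s0).
have [t0|t0] := ltP 0 t; last by rewrite subr0 subr_ge0.
by rewrite (powRr1 (ltW t0)); lra.
Qed.

Lemma RLconv_lipschitz_ge (d N p S : R) (V : R -> R) : 0 < d -> 0 <= N ->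
  continuous V -> causal V -> p < S -> (forall x, x <= p -> V x = 0) ->
  (forall x y, x < S -> y < S -> `|V x - V y| <= N * `|x - y|) ->
  forall x y, x < S -> y < S ->
  `|RLconv d V x - RLconv d V y| <= N * ((S - p) `^ d / d) * `|x - y|.
Proof.
move=> d0 N0 cV V0 pS Vp VN x y xS yS.
have iV r : mu.-integrable `]0, (S - p)[ (EFin \o (fun u => RLker d u * V (r - u))).
  by apply: (@integrableS _ _ _ _ setT) => //; exact: integrable_RLconv.
have mB : measurable (`]0, (S - p)[%classic : set (measurableTypeR R)) by [].
have iB := integrableB mB (iV x) (iV y).
have SE : p + (S - p) = S by rewrite addrC subrK.
rewrite !(@RLconv_itv _ d p V _ (S - p))// ?SE ?(ltW xS) ?(ltW yS)//.
rewrite -RintegralB//.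
apply: (le_trans (le_normr_Rintegral mB iB)).
have iK := integrableZl mB (N * `|x - y|) (integrable_RLker (S - p) d0).
apply: (@le_trans _ _ (\int[mu]_(u in `]0, (S - p)[) (N * `|x - y| * RLker d u))).
  apply: le_Rintegral => //; first by have := integrable_abse iB.
  move=> u /=; rewrite in_itv/= => /andP[u0 _].
  rewrite -mulrBr normrM (ger0_norm (RLker_ge0 _ _)) mulrC ler_wpM2r ?RLker_ge0//.
  rewrite (le_trans (VN _ _ _ _))//.
  - by rewrite ltrBlDr (lt_trans xS)// ltrDl.
  - by rewrite ltrBlDr (lt_trans yS)// ltrDl.
  - by rewrite opprB addrA subrK.
rewrite RintegralZl//; last exact: integrable_RLker.
rewrite [leRHS]mulrAC ler_wpM2l ?mulr_ge0// Rintegral_RLker_le// subr_gt0//.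
Qed.

End regularity.

(** * Uniqueness for the Volterra equation *)
Section uniqueness.
Context {R : realType}.
Notation mu := (@lebesgue_measure R).

Lemma lipschitz_derive1_le (f : R -> R) (C S t : R) : t < S -> derivable f t 1 ->
  (forall x y, x < S -> y < S -> `|f x - f y| <= C * `|x - y|) ->
  `|f^`()%classic t| <= C.
Proof.
move=> tS df fC; rewrite /derive1.
have cf : cvg (h^-1 *: (f (h + t) - f t) @[h --> 0^']).
  by move: df; rewrite /derivable; under eq_fun do rewrite /= scaler1.
have cn := @cvg_norm _ _ _ _ (dnbhs_filter _) _ _ cf.
rewrite -(cvg_lim _ cn)//; apply: limr_le; first exact: cvgP cn.
near=> h.
have h0 : h != 0 by near: h; exact: nbhs_dnbhs_neq.
have hS : h + t < S.
  rewrite -ltrBrDr; near: h; apply: nbhs_dnbhs; apply: lt_nbhsl.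
  by rewrite subr_gt0.
rewrite normrZ normfV ler_pdivrMl ?normr_gt0// mulrC (le_trans (fC _ _ hS tS))//.
by rewrite addrK.
Unshelve. all: by end_near. Qed.

Lemma exists_small_sum (m : nat) (K : R) (d : nat -> R) :
  (forall i, (i < m)%N -> 0 < d i) ->
  exists2 e, 0 < e & \sum_(i < m) K * (e `^ d i / d i) <= 2^-1.
Proof.
move=> d0.
have : \sum_(i < m) K * (e `^ d i / d i) @[e --> 0^'+] --> 0.
  elim: m d0 => [|m ih] d0.
    by under eq_fun do rewrite big_ord0; exact: cvg_cst.
  have c1 : K * (e `^ d m / d m) @[e --> 0^'+] --> K * (0 / d m).
    apply: cvgM; first exact: cvg_cst.
    by apply: cvgM; [exact/powR_cvg0/d0|exact: cvg_cst].
  have c2 := ih (fun i im => d0 i (ltn_trans im (ltnSn m))).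
  have c3 : (\sum_(i < m) K * (e `^ d i / d i)) + K * (e `^ d m / d m) @[e --> 0^'+]
      --> 0 + K * (0 / d m) by exact: cvgD.
  rewrite mul0r mulr0 addr0 in c3.
  rewrite (_ : (fun e : R => _) = (fun e : R => \sum_(i < m) K * (e `^ d i / d i) +
    K * (e `^ d m / d m)))//.
  by apply/funext => e; rewrite big_ord_recr.
have half_gt0 : 0 < 2^-1 :> R by rewrite invr_gt0.
move=> /cvgrPdist_le/(_ _ half_gt0) h.
near (0 : R)^'+ => e.
exists e; first by near: e; exact: nbhs_right_gt.
rewrite (le_trans (ler_norm _))// -normrN -sub0r.
by near: e; exact: h.
Unshelve. all: by end_near. Qed.

Lemma exp2N_le0 (x y : R) : (forall n, x <= y / 2 ^+ n) -> x <= 0.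
Proof.
move=> h; rewrite leNgt; apply/negP => x0.
have y0 : 0 < y.
  by have := h 0%N; rewrite expr0 divr1; exact: lt_le_trans.
have := h (Num.truncn (y / x)).+1; rewrite leNgt; move/negP; apply.
rewrite ltr_pdivrMr ?exprn_gt0// mulrC -ltr_pdivrMr//.
apply: (lt_trans (truncnS_gt _)).
by rewrite -natrX ltr_nat ltn_expl.
Qed.

Section homogeneous_volterra.
Variables (T L K : R) (m : nat) (V : R -> R) (d : nat -> R) (b : nat -> R -> R).
Hypotheses (cV : continuous V) (V0 : causal V).
Hypothesis VL : forall s t, s <= t -> `|V t - V s| <= L * (t - s).
Hypothesis d0 : forall i, (i < m)%N -> 0 < d i.
Hypotheses (K0 : 0 <= K)
  (bK : forall i t, (i < m)%N -> 0 < t < T -> `|b i t| <= K).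
Hypothesis dV : forall t, 0 < t < T -> derivable V t 1.
Hypothesis dW : forall i t, (i < m)%N -> 0 < t < T -> derivable (RLconv (d i) V) t 1.
Hypothesis VE : forall t, 0 < t < T ->
  V^`()%classic t = \sum_(i < m) b i t * (RLconv (d i) V)^`()%classic t.

(** The equation bounds the derivative of [V] on ]0, S[ by [N] times the small sum, hence by
    [N / 2]; the mean value theorem turns this back into a Lipschitz bound. *)
Lemma volterra_lipschitz_halved (p S e N : R) : 0 <= p -> p < S -> S <= T ->
  S - p <= e -> \sum_(i < m) K * (e `^ d i / d i) <= 2^-1 ->
  (forall x, x <= p -> V x = 0) -> 0 <= N ->
  (forall x y, x < S -> y < S -> `|V x - V y| <= N * `|x - y|) ->
  (forall x y, x < S -> y < S -> `|V x - V y| <= N / 2 * `|x - y|).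
Proof.
move=> p0 pS ST Spe He Vp N0 VN.
have dVN t : 0 < t -> t < S -> `|V^`()%classic t| <= N / 2.
  move=> t0 tS; have tT : 0 < t < T by rewrite t0 (lt_le_trans tS).
  rewrite VE// (le_trans (ler_norm_sum _ _ _))//.
  apply: (@le_trans _ _ (\sum_(i < m) N * (K * (e `^ d i / d i)))); last first.
    by rewrite -mulr_sumr ler_wpM2l.
  apply: ler_sum => i _; rewrite normrM.
  rewrite mulrCA ler_pM ?bK//.
  apply: le_trans (lipschitz_derive1_le tS (dW (ltn_ord i) tT)
    (@RLconv_lipschitz_ge R (d i) N p S V (d0 (ltn_ord i)) N0 cV V0 pS Vp VN)) _.
  have di0 := d0 (ltn_ord i); have Sp0 : 0 <= S - p by rewrite subr_ge0 ltW.
  rewrite ler_wpM2l// ler_wpM2r ?invr_ge0 ?(ltW di0)//.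
  by apply: ge0_ler_powR; rewrite ?nnegrE ?(ltW di0)// (le_trans Sp0).
have pos x y : 0 <= x -> x <= y -> y < S -> `|V x - V y| <= N / 2 * `|x - y|.
  move=> x0; rewrite le_eqVlt => /orP[/eqP->|xy] yS; first by rewrite !subrr normr0 mulr0.
  have dVc c : c \in `]x, y[ -> is_derive c 1 V (V^`()%classic c).
    rewrite in_itv/= => /andP[xc cy]; rewrite derive1E.
    apply: derivableP; apply: dV.
    by rewrite (le_lt_trans x0 xc) (lt_le_trans _ ST)// (lt_trans cy).
  have [c cxy Vxy] := MVT xy dVc (continuous_subspaceT cV).
  move: cxy; rewrite in_itv/= => /andP[xc cy].
  rewrite distrC Vxy normrM (distrC x) ler_wpM2r// dVN//.
    exact: le_lt_trans xc.
  exact: lt_trans yS.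
(* Negative arguments are moved to 0, where [V] takes the same value; this does not increase
   distances. *)
have Vmax x : V x = V (Num.max x 0).
  by case: (leP x 0) => x0 //; rewrite !V0.
move=> x y xS yS; wlog xy : x y xS yS / x <= y.
  move=> H; have [/H->//|/ltW/H] := leP x y.
  by rewrite distrC (distrC x); apply.
have S0 : 0 < S by exact: le_lt_trans pS.
rewrite (Vmax x) (Vmax y).
apply: le_trans (pos _ _ _ _ _) _.
- by rewrite le_max lexx orbT.
- by rewrite ge_max !le_max xy lexx orbT.
- by rewrite gt_max yS.
rewrite ler_wpM2l ?divr_ge0//.
rewrite (distrC x) (distrC (Num.max x 0)) !ger0_norm ?subr_ge0//.
  by case: (leP x 0) => x0; case: (leP y 0) => y0; lra.
by rewrite ge_max !le_max xy lexx orbT.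
Qed.

(** Induction on the number of steps of length [e / 2]. On each window the halving can be iterated,
    so the Lipschitz constant is at most [L / 2 ^+ k] for every [k]. *)
Lemma volterra_unique x : x < T -> V x = 0.
Proof.
have [e e0 He] := @exists_small_sum m K d d0.
have L0 : 0 <= L.
  have := VL ler01; rewrite subr0 mulr1; exact: le_trans.
suff H n y : y <= n%:R * (e / 2) -> y < T -> V y = 0.
  move=> xT; apply: (H (Num.truncn (x / (e / 2))).+1) => //.
  by rewrite -ler_pdivrMr ?divr_gt0// ltW// truncnS_gt.
elim: n y => [|n ih] y yn yT; first by apply: V0; rewrite mul0r in yn.
(* The window has length up to [e] but the induction advances only by [e / 2], so that [y] lies
   strictly below [S]. *)
pose p := n%:R * (e / 2); pose S := Num.min (p + e) T.
have [yp|py] := leP y p; first exact: ih.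
have pT : p < T by exact: lt_trans yT.
have pS : p < S by rewrite lt_min pT ltrDl e0.
have p0 : 0 <= p by rewrite mulr_ge0 ?divr_ge0// ltW.
have ST : S <= T by rewrite ge_min lexx orbT.
have Spe : S - p <= e by rewrite lerBlDl ge_min lexx.
have Vp z : z <= p -> V z = 0 by move=> zp; apply: ih => //; exact: le_lt_trans pT.
have yS : y < S.
  rewrite lt_min yT andbT (le_lt_trans yn)// -natr1 mulrDl mul1r ltrD2l.
  by rewrite gtr_pMr// invf_lt1// ltr1n.
have LN k : forall x z, x < S -> z < S -> `|V x - V z| <= L / 2 ^+ k * `|x - z|.
  elim: k => [|k ihk].
    move=> w z _ _; rewrite expr0 divr1; have [wz|/ltW zw] := leP w z.
      by rewrite distrC (distrC w) (ger0_norm (_ : 0 <= z - w)) ?subr_ge0// VL.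
    by rewrite (ger0_norm (_ : 0 <= w - z)) ?subr_ge0// VL.
  rewrite exprSr invfM mulrA.
  apply: (@volterra_lipschitz_halved p S e) => //.
  by rewrite divr_ge0// exprn_ge0.
apply/eqP; rewrite -normr_le0; apply: (@exp2N_le0 _ (L * `|y|)) => k.
have := LN k y 0 yS (le_lt_trans p0 pS).
by rewrite (V0 (lexx 0)) !subr0 mulrAC.
Qed.

End homogeneous_volterra.

(** Applying the integral of order [1 - g] gives, by the semigroup law, the ordinary primitive of
    [G] up to a factor at least 1. This primitive vanishes below [T], and differentiating it
    recovers [G]. *)
Lemma RLconv_inj (g T : R) (G : R -> R) : 0 < g < 1 -> continuous G -> causal G ->
  (forall x, x < T -> RLconv g G x = 0) -> forall x, x < T -> G x = 0.
Proof.
move=> /andP[g0 g1] cG G0 gG x xT; have [x0|x0] := leP x 0; first exact: G0.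
have g10 : 0 < 1 - g by rewrite subr_gt0.
have I0 t : t < T -> \int[mu]_(s in `]0, t[) G s = 0.
  move=> tT; have := @RLconv_semigroup R g (1 - g) G t g0 g10 cG G0.
  rewrite {1}/RLconv (@eq_Rintegral _ _ _ mu _ (cst 0)); last first.
    move=> u _; have [u0|u0] := leP u 0; first by rewrite RLker_le0// mul0r.
    by rewrite gG ?mulr0// ltrBlDr (lt_trans tT)// ltrDl.
  rewrite Rintegral_cst// mul0r => /esym/eqP; rewrite mulf_eq0 gt_eqF/=; last first.
    by rewrite (lt_le_trans ltr01)// RLbeta_ge1 ?g0 ?g10 ?(ltW g1)// gerBl ltW.
  rewrite addrC subrK RLconvE// => /eqP h; rewrite -[RHS]h.
  by apply: eq_Rintegral => s _; rewrite subrr powRr0 mul1r.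
have iG s : mu.-integrable `[0, s] (EFin \o G).
  apply: continuous_compact_integrable; first exact: segment_compact.
  exact: continuous_subspaceT.
have xx1 : x < x + 1 by rewrite ltrDl.
have [|dG <-] := @continuous_FTC1 R G (BLeft 0) x (x + 1) xx1 (iG _) _ (cG x).
  by rewrite lte_fin.
rewrite derive1E (@near_eq_derive _ _ _ _ (cst 0)) ?derive_cst//.
near=> t; rewrite -[RHS](I0 t); last by near: t; exact: lt_nbhsl.
have iG1 : mu.-integrable `]0, t[ (EFin \o G).
  by apply: integrableS (iG t) => //; exact: subset_itv_oo_cc.
have iG2 : mu.-integrable `]0, t] (EFin \o G).
  by apply: integrableS (iG t) => //; exact: subset_itv_oc_cc.
by rewrite Rintegral_itv_bndo_bndc// Rintegral_itv_obnd_cbnd.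
Unshelve. all: by end_near. Qed.

End uniqueness.

(** * Positivity of the Gamma function on ]0, 1] *)

Section Gamma.
Context {R : realType}.
Notation mu := (@lebesgue_measure R).

(** The majorant is the kernel on ]0, 1[ plus the exponential density, which dominates for [x >= 1]
    because the power is then at most 1. *)
Lemma integrable_Gamma (a : R) : 0 < a -> a <= 1 ->
  mu.-integrable `]0, +oo[ (EFin \o (fun x => x `^ (a - 1) * expR (- x))).
Proof.
move=> a0 a1.
have mD : measurable (`]0, +oo[%classic : set (measurableTypeR R)) by [].
have ik : mu.-integrable `]0, +oo[ (EFin \o (RLker a \_ `]0, 1[)).
  by apply: integrableS (integrable_RLkerT 1 a0).
have ie : mu.-integrable `]0, +oo[ (EFin \o exponential_pdf 1).
  by apply: integrableS (integrable_exponential_pdf ltr01).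
have ih := integrableD mD ik ie.
apply: le_integrable ih => //.
  apply/measurable_EFinP; apply: measurable_funM.
    by apply: measurable_funTS; exact: measurable_powR.
  apply: measurableT_comp => //; exact: measurable_expR.
move=> x /=; rewrite in_itv/= andbT => x0.
rewrite !lee_fin ger0_norm ?mulr_ge0 ?powR_ge0 ?expR_ge0//.
rewrite (le_trans _ (ler_norm _))// /exponential_pdf !patchE !mem_setE !in_itv/=.
rewrite x0 (ltW x0)/= mul1r mulN1r.
have [x1|x1] := ltP x 1.
  rewrite -[leLHS]addr0 lerD ?expR_ge0// RLker_gt0//.
  by rewrite -[leRHS]mulr1 ler_wpM2l ?powR_ge0// -expR0 ler_expR oppr_le0 ltW.
rewrite add0r -[leRHS]mul1r ler_wpM2r ?expR_ge0//.
by rewrite -[leRHS](powRr0 x); apply: ler_powR; rewrite ?subr_le0.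
Qed.

(** On ]0, 1[ the power is at least 1 and the exponential at least [expR (-1)]. *)
Lemma Gamma_gt0 (a : R) : 0 < a -> a <= 1 -> 0 < Gamma a.
Proof.
move=> a0 a1; have ig := integrable_Gamma a0 a1.
apply: (@lt_le_trans _ _ (expR (-1))); first exact: expR_gt0.
rewrite /Gamma -lee_fin fineK; last exact: integrable_fin_num.
have mf : measurable_fun setT (fun x : R => (x `^ (a - 1) * expR (- x))%:E).
  apply/measurable_EFinP; apply: measurable_funM; first exact: measurable_powR.
  apply: measurableT_comp => //; exact: measurable_expR.
apply: (@le_trans _ _ (\int[mu]_(x in `]0%R, 1%R[) (x `^ (a - 1) * expR (- x))%:E)%E); last first.
  apply: ge0_subset_integral => //.
  - by apply: measurable_funTS.
  - by move=> x _; rewrite lee_fin mulr_ge0 ?powR_ge0 ?expR_ge0.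
  - by move=> x /=; rewrite !in_itv/= andbT => /andP[].
have -> : (expR (-1))%:E = (\int[mu]_(x in `]0%R, 1%R[) (expR (-1))%:E)%E.
  rewrite integral_cst//= lebesgue_measure_itv/= lte_fin ltr01.
  by rewrite oppr0 adde0 mule1.
apply: ge0_le_integral => //.
- by apply: measurable_funTS.
- move=> x /=; rewrite in_itv/= => /andP[x0 x1]; rewrite lee_fin.
  rewrite -[leLHS]mul1r ler_pM ?expR_ge0 ?ler_expR ?lerN2 ?(ltW x1)//.
  by rewrite -[leLHS](powRr0 x); apply: ger_powR; rewrite ?x0 ?(ltW x1) ?subr_le0.
Qed.

Lemma order_ofE (a : R) (n : nat) : n%:R - 1 < a <= n%:R -> order_of a = n.
Proof.
move=> an; rewrite /order_of (@ceil_def _ a n%:Z)//.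
by rewrite rmorphB.
Qed.

End Gamma.

(** * Derivatives relative to an interval *)
Section interval_derivative.
Context {R : realType}.

(** Carathéodory's slope function is the difference quotient completed by [l] at [x]; its continuity
    at [x] is exactly the convergence of the quotients. *)
Lemma is_derive_diff_quotP (f : R -> R) (x l : R) :
  is_derive x 1 f l <-> diff_quot f x y @[y --> x^'] --> l.
Proof.
rewrite is_derive1_caratheodory; split.
  move=> [g [fg cg <-]]; have /continuous_withinNx := cg.
  apply: cvg_trans; apply: near_eq_cvg; near=> y.
  have yx : y != x by near: y; exact: nbhs_dnbhs_neq.
  by rewrite /diff_quot fg mulfK// subr_eq0.
move=> fl; exists (fun y => if y == x then l else diff_quot f x y); split.
- move=> z; case: eqVneq => [->|zx]; first by rewrite !subrr mulr0.
  by rewrite /diff_quot divfK// subr_eq0.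
- apply/continuous_withinNx; rewrite eqxx.
  apply: cvg_trans fl; apply: near_eq_cvg; near=> y.
  have yx : y != x by near: y; exact: nbhs_dnbhs_neq.
  by rewrite (negbTE yx).
- by rewrite eqxx.
Unshelve. all: by end_near. Qed.

(** Points of [0, T] accumulate at [x]: from the right if [x < T], from the left at [T]. Properness
    makes limits unique, so that [derive_in] can be computed from any convergence proof. *)
Lemma within_dnbhs_proper (T x : R) : 0 < T -> 0 <= x <= T ->
  ProperFilter (within `[0, T] x^').
Proof.
move=> T0 /andP[x0 xT]; apply: Build_ProperFilter_ex => P.
rewrite /within/= => /nbhs_ballP[e /= e0 h].
have [xT'|Tx] := ltP x T.
  pose d := Num.min e (T - x) / 2.
  have m0 : 0 < Num.min e (T - x) by rewrite lt_min e0 subr_gt0.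
  have d0 : 0 < d by rewrite divr_gt0.
  have de : d < e.
    by rewrite /d ltr_pdivrMr// (@le_lt_trans _ _ e) ?ge_min ?lexx// ltr_pMr// ltr1n.
  have dT : d <= T - x.
    rewrite /d ler_pdivrMr// (@le_trans _ _ (T - x)) ?ge_min ?lexx ?orbT//.
    by rewrite ler_pMr ?subr_gt0// ler1n.
  exists (x + d); apply: h.
  - by rewrite /ball/= opprD addNKr normrN gtr0_norm.
  - by rewrite -subr_eq0 addrC addKr gt_eqF.
  - by rewrite /= in_itv/= addr_ge0 ?(ltW d0)//= addrC -lerBrDr.
pose d := Num.min e x / 2.
have x0' : 0 < x by exact: lt_le_trans Tx.
have m0 : 0 < Num.min e x by rewrite lt_min e0.
have d0 : 0 < d by rewrite divr_gt0.
have de : d < e.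
  by rewrite /d ltr_pdivrMr// (@le_lt_trans _ _ e) ?ge_min ?lexx// ltr_pMr// ltr1n.
have dx : d <= x.
  rewrite /d ler_pdivrMr// (@le_trans _ _ x) ?ge_min ?lexx ?orbT//.
  by rewrite ler_pMr// ler1n.
exists (x - d); apply: h.
- by rewrite /ball/= opprB addrC subrK gtr0_norm.
- by rewrite -subr_eq0 addrAC subrr sub0r oppr_eq0 gt_eqF.
- by rewrite /= in_itv/= subr_ge0 dx/= (le_trans _ xT)// gerBl ltW.
Qed.

Lemma cvg_diff_quot_derive_in (T x l : R) (f : R -> R) : 0 < T -> 0 <= x <= T ->
  diff_quot f x y @[y --> within `[0, T] x^'] --> l -> derive_in `[0, T] f x = l.
Proof.
move=> T0 xT fl; have FF := within_dnbhs_proper T0 xT.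
exact: cvg_lim fl.
Qed.

Lemma derivable_in_cvg (A : set R) (f : R -> R) (x : R) : derivable_in A f x ->
  diff_quot f x y @[y --> within A x^'] --> derive_in A f x.
Proof. by []. Qed.

Lemma is_derive_in (T x l : R) (f g : R -> R) : 0 < T -> 0 <= x <= T ->
  (forall y, 0 <= y <= T -> f y = g y) -> is_derive x 1 g l ->
  diff_quot f x y @[y --> within `[0, T] x^'] --> l.
Proof.
move=> T0 xT fg /is_derive_diff_quotP gl.
apply: (@cvg_trans _ (diff_quot g x y @[y --> within `[0, T] x^'])).
  apply: near_eq_cvg; near=> y.
  have yT : 0 <= y <= T.
    suff : y \in `[0, T] by rewrite in_itv.
    near: y; exact: withinT.
  by rewrite /diff_quot !fg.
apply: cvg_trans gl; apply: cvg_app; exact: cvg_within.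
Unshelve. all: by end_near. Qed.

Lemma diff_quot_itv_is_derive (T x l : R) (f : R -> R) : 0 < x < T ->
  diff_quot f x y @[y --> within `[0, T] x^'] --> l -> is_derive x 1 f l.
Proof.
move=> /andP[x0 xT] fl; apply/is_derive_diff_quotP => P /fl /= h.
have hA : \forall y \near x^', `[0, T]%classic y.
  apply: nbhs_dnbhs; near=> y; rewrite /= in_itv/=; apply/andP; split.
    by apply: ltW; near: y; exact: lt_nbhsr.
  by apply: ltW; near: y; exact: lt_nbhsl.
by apply: filterS2 hA h => y Ay; exact.
Unshelve. all: by end_near. Qed.

(** The retraction of the line onto [0, T]. Composing with it extends a function on [0, T]
    continuously by its end values, as the convolution lemmas require. *)
Definition clamp (T x : R) : R := Num.min (Num.max x 0) T.

Lemma clampP (T x : R) : 0 <= T -> 0 <= clamp T x <= T.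
Proof. by move=> T0; rewrite /clamp le_min T0 le_max lexx orbT ge_min lexx orbT. Qed.

Lemma clamp_id (T x : R) : 0 <= x <= T -> clamp T x = x.
Proof. by move=> /andP[x0 xT]; rewrite /clamp max_l// min_l. Qed.

Lemma clamp_le0 (T x : R) : 0 <= T -> x <= 0 -> clamp T x = 0.
Proof. by move=> T0 x0; rewrite /clamp max_r// min_l. Qed.

Lemma continuous_clamp (T : R) : continuous (clamp T).
Proof.
move=> x; have c0 (c : R) : {for x, continuous (fun _ : R => c : R^o)} by exact: cvg_cst.
have cid : {for x, continuous (fun y : R => y : R^o)} by exact: cvg_id.
exact: continuous_min (continuous_max cid (c0 0)) (c0 T).
Qed.

Lemma continuous_comp_clamp (T : R) (f : R -> R) : 0 <= T ->
  {within `[0, T], continuous f} -> continuous (f \o clamp T).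
Proof.
move=> T0 /subspace_continuousP cf x.
have xT : `[0, T]%classic (clamp T x) by rewrite /= in_itv/= clampP.
apply: (@cvg_trans _ (f y @[y --> within `[0, T] (nbhs (clamp T x))])).
  move=> P hP.
  have hP' : nbhs (clamp T x) [set y | `[0, T]%classic y -> P (f y)] := hP.
  have hc : \forall y \near x, `[0, T]%classic (clamp T y) -> P (f (clamp T y)) :=
    @continuous_clamp T x _ hP'.
  suff : \forall y \near x, P (f (clamp T y)) by [].
  by apply: filterS hc => y; apply; rewrite /= in_itv/= clampP.
exact: cf.
Qed.

End interval_derivative.

(** * Uniqueness for the fractional equation *)
Section caputo_homogeneous.
Context {R : realType}.
Notation mu := (@lebesgue_measure R).
Variables (T : R) (n : nat) (D : nat -> R -> R) (u : R -> R).
Hypothesis cD : forall k, (k <= n)%N -> continuous (D k).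
Hypothesis D0 : forall k, (k <= n)%N -> causal (D k).
Hypothesis dD : forall k, (k < n)%N -> forall x, x < T -> is_derive x 1 (D k) (D k.+1 x).
Hypothesis uD : forall t, 0 < t < T -> u t = D 0%N t.

(** All [D k] up to order [n] are continuous and vanish up to 0, so every derivative passes under
    the integral. *)
Lemma RLint_derive1n (b t : R) (k : nat) : 0 < b -> (k <= n)%N -> 0 < t < T ->
  (RLint b u)^`(k)%classic t = (Gamma b)^-1 * RLconv b (D k) t.
Proof.
move=> b0; elim: k t => [|k ih] t kn tT.
  rewrite derive1n0 /RLint gt_eqF//; congr (_ * _).
  rewrite RLconvE//; [|exact: cD|exact: D0].
  apply: eq_Rintegral => s; rewrite inE/= in_itv/= => /andP[s0 st].
  (* The integral up to [t] only sees [u] on ]0, t[, where it coincides with [D 0]. *)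
  by rewrite uD// s0 (lt_trans st)//; case/andP : tT.
have [t0 tT'] := andP tT.
rewrite derive1nS derive1E.
rewrite (@near_eq_derive _ _ _ _ (fun s => (Gamma b)^-1 * RLconv b (D k) s)); last first.
  near=> s; apply: ih; first exact: ltnW.
  apply/andP; split; near: s; [exact: lt_nbhsr|exact: lt_nbhsl].
have dk : is_derive t 1 (RLconv b (D k)) (RLconv b (D k.+1) t).
  apply: (is_derive_RLconv b0 (cD (ltnW kn)) (D0 (ltnW kn)) (cD kn) (D0 kn) _ tT').
  exact: dD.
by have [_ ->] := is_deriveZ (Gamma b)^-1 dk.
Unshelve. all: by end_near. Qed.

(** [D n] need not be differentiable, so the last derivative stays outside the integral and its
    existence is assumed. As [Gamma b] is nonzero, derivability passes from [RLint] to [RLconv]. *)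
Lemma RLint_derive1n_last (b t : R) : 0 < b -> b <= 1 -> 0 < t < T ->
  derivable ((RLint b u)^`(n)%classic) t 1 ->
  derivable (RLconv b (D n)) t 1 /\
  (RLint b u)^`(n.+1)%classic t = (Gamma b)^-1 * (RLconv b (D n))^`()%classic t.
Proof.
move=> b0 b1 tT dR; have [t0 tT'] := andP tT.
have G0 := Gamma_gt0 b0 b1.
have E : \forall s \near t, (RLint b u)^`(n)%classic s = (Gamma b)^-1 * RLconv b (D n) s.
  near=> s; apply: RLint_derive1n => //.
  apply/andP; split; near: s; [exact: lt_nbhsr|exact: lt_nbhsl].
have dC : derivable (RLconv b (D n)) t 1.
  have : derivable (Gamma b \*: (fun s => (Gamma b)^-1 * RLconv b (D n) s)) t 1.
    by apply: derivableZ; exact: near_eq_derivable E dR.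
  rewrite (_ : _ \*: _ = RLconv b (D n))//.
  by apply/funext => s; rewrite /= /GRing.scale/= mulVKf// gt_eqF.
split => //; rewrite derive1nS derive1E (near_eq_derive _ E) -derive1E.
by rewrite derive1Ml.
Unshelve. all: by end_near. Qed.

(** Descends from [D n]: a function with zero derivative below [T] and value 0 at 0 is zero. *)
Lemma causal_derive_eq0 : (forall x, x < T -> D n x = 0) ->
  forall k, (k <= n)%N -> forall x, x < T -> D k x = 0.
Proof.
move=> Dn; suff H i : (i <= n)%N -> forall x, x < T -> D (n - i)%N x = 0.
  by move=> k kn; rewrite -(subKn kn); apply: H; rewrite leq_subr.
elim: i => [_|i ih iln] x xT; first by rewrite subn0 Dn.
have [x0|x0] := leP x 0; first by rewrite D0// leq_subr.
have kn : (n - i.+1 < n)%N by rewrite ltn_subrL (leq_trans _ iln).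
have [||c] := @MVT_segment R (D (n - i.+1)%N) (D (n - i.+1).+1) 0 x (ltW x0).
- by move=> c; rewrite in_itv/= => /andP[_ cx]; apply: dD => //; exact: lt_trans xT.
- by apply: continuous_subspaceT; apply: cD; exact: ltnW.
rewrite in_itv/= => /andP[_ cx]; rewrite -subSn// subSS ih; last 2 first.
- exact: ltnW.
- exact: le_lt_trans xT.
by rewrite mul0r (D0 (ltnW kn) (lexx 0)) subr0.
Qed.

Lemma lipschitz_continuous (f : R -> R) (L : R) :
  (forall s t, s <= t -> `|f t - f s| <= L * (t - s)) -> continuous f.
Proof.
move=> fL x; apply/cvgrPdist_le => e e0.
have L0 : 0 <= L by have := fL _ _ ler01; rewrite subr0 mulr1; exact: le_trans.
have fL' s t : `|f t - f s| <= L * `|t - s|.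
  have [st|/ltW ts] := leP s t; first by rewrite (ger0_norm (_ : 0 <= t - s)) ?subr_ge0// fL.
  by rewrite distrC (distrC t) (ger0_norm (_ : 0 <= s - t)) ?subr_ge0// fL.
near=> y; apply: (le_trans (fL' _ _)).
apply: (@le_trans _ _ ((L + 1) * `|x - y|)).
  by rewrite ler_wpM2r// lerDl.
rewrite mulrC -ler_pdivlMr ?ltr_wpDl//; near: y.
by apply: cvgr_dist_le => //; rewrite divr_gt0// ltr_wpDl.
Unshelve. all: by end_near. Qed.

Variables (m : nat) (M : R) (beta : nat -> R) (a : nat -> R -> R).
(** [beta i] stands for n0 - alpha_i with n0 = [n.+1], so [g] is gamma. *)
Let g := beta 0%N.
Hypotheses (M0 : 0 <= M) (g01 : 0 < g < 1).
Hypothesis DM : forall s t, s <= t ->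
  `|D n t - D n s| <= M * (RLker (2 - g) t - RLker (2 - g) s).
Hypothesis betaP : forall i, (1 <= i <= m)%N -> g < beta i < 1.
Hypothesis aK : forall i, (1 <= i <= m)%N ->
  exists2 K, 0 <= K & forall t, 0 < t < T -> `|a i t| <= K.
Hypothesis dR : forall i, (i <= m)%N -> forall t, 0 < t < T ->
  derivable ((RLint (beta i) u)^`(n)%classic) t 1.
Hypothesis eqR : forall t, 0 < t < T -> (RLint g u)^`(n.+1)%classic t =
  - \sum_(1 <= i < m.+1) a i t * (RLint (beta i) u)^`(n.+1)%classic t.

(** For [V], the integral of order [g] of [D n], the equation becomes a homogeneous Volterra
    equation with orders [d i = beta i.+1 - g]. Hence [V] vanishes, then [D n] by injectivity, then
    all lower [D k]. *)
Lemma caputo_homogeneous_unique k x : (k <= n)%N -> x < T -> D k x = 0.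
Proof.
have [g0 g1] := andP g01; have cn := cD (leqnn n); have Dn0 := D0 (leqnn n).
move=> kn; move: x; apply: causal_derive_eq0 => //.
apply: (@RLconv_inj _ g) => //.
pose V := RLconv g (D n); pose L := M * RLbeta (2 - g) g.
have VL s t : s <= t -> `|V t - V s| <= L * (t - s).
  exact: (RLconv_lipschitz g01 M0 cn Dn0 DM).
have cV : continuous V by exact: lipschitz_continuous VL.
have V0 : causal V by exact: RLconv_causal.
pose d i := beta i.+1 - g.
have im1 i : (i < m)%N -> (1 <= i.+1 <= m)%N by [].
have d0 i : (i < m)%N -> 0 < d i.
  by move=> /im1 /betaP /andP[? _]; rewrite subr_gt0.
have d1 i : (i < m)%N -> d i <= 1.
  move=> /im1 /betaP /andP[_ h]; rewrite /d; lra.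
pose B i := RLbeta g (d i).
have B0 i : (i < m)%N -> 0 < B i.
  move=> im; apply: lt_le_trans ltr01 (RLbeta_ge1 _ _); first by rewrite g0 ltW.
  by rewrite d0// d1.
have WE i : (i < m)%N -> RLconv (d i) V = (fun x => B i * RLconv (beta i.+1) (D n) x).
  move=> im; apply/funext => x; rewrite (RLconv_semigroup x g0 (d0 _ im) cn Dn0).
  by rewrite (_ : g + d i = beta i.+1)// /d addrC subrK.
have b01 i : (i < m)%N -> 0 < beta i.+1 /\ beta i.+1 <= 1.
  by move=> /im1 /betaP /andP[h /ltW]; split=> //; exact: lt_trans h.
have dC i t : (i < m)%N -> 0 < t < T -> derivable (RLconv (beta i.+1) (D n)) t 1 /\
  (RLint (beta i.+1) u)^`(n.+1)%classic t =
    (Gamma (beta i.+1))^-1 * (RLconv (beta i.+1) (D n))^`()%classic t.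
  move=> im tT; have [? ?] := b01 _ im.
  by apply: RLint_derive1n_last => //; apply: dR.
(* [Gamma g] and [Gamma (beta i.+1)] come from the normalisations of [RLint] on the two sides, [B i]
   from the semigroup law. *)
pose c i := Gamma g / (Gamma (beta i.+1) * B i).
pose b i t := - (a i.+1 t * c i).
have [K K0 bK] : exists2 K, 0 <= K &
    forall i t, (i < m)%N -> 0 < t < T -> `|b i t| <= K.
  have aK' (i : 'I_m) : exists K, 0 <= K /\ forall t, 0 < t < T -> `|a i.+1 t| <= K.
    by have [K K0 aK''] := aK (im1 _ (ltn_ord i)); exists K.
  have [K KP] := choice aK'.
  exists (\sum_(i < m) K i * `|c i|).
    by apply: sumr_ge0 => i _; rewrite mulr_ge0//; case: (KP i).
  move=> i t im tT; rewrite (bigD1 (Ordinal im))//= normrN normrM.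
  have [K0 h] := KP (Ordinal im).
  apply: ler_wpDr.
    by apply: sumr_ge0 => j _; rewrite mulr_ge0//; case: (KP j).
  by rewrite ler_wpM2r// h.
apply: (@volterra_unique R T L K m V d b) => //.
- by move=> t tT; have [] := RLint_derive1n_last g0 (ltW g1) tT (dR (leq0n _) tT).
- move=> i t im tT; rewrite WE//; have [dct _] := dC i t im tT.
  exact: derivableZ.
move=> t tT; have [dVt] := RLint_derive1n_last g0 (ltW g1) tT (dR (leq0n _) tT).
have Gg0 := Gamma_gt0 g0 (ltW g1).
rewrite eqR// => /(congr1 (fun z => Gamma g * z)).
rewrite mulVKf ?gt_eqF// => <-.
rewrite big_add1/= big_mkord mulrN mulr_sumr -sumrN; apply: eq_bigr => i _.
have [dct dE] := dC i t (ltn_ord i) tT.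
rewrite -derive1nS dE WE// derive1Ml// /b /c.
have [h1 h2] := b01 _ (ltn_ord i); have := Gamma_gt0 h1 h2.
have := B0 _ (ltn_ord i) => Bi0 Gi0; field.
by rewrite !gt_eqF.
Qed.

End caputo_homogeneous.

(** * Derivatives and growth of functions extended from the interval *)

Section clamped_derivatives.
Context {R : realType}.

Lemma is_derive_comp_clamp (T x l : R) (f : R -> R) : 0 < x < T ->
  diff_quot f x y @[y --> within `[0, T] x^'] --> l ->
  is_derive x 1 (f \o clamp T) l.
Proof.
move=> xT /(diff_quot_itv_is_derive xT) df; have [x0 xT'] := andP xT.
apply: near_eq_is_derive df; near=> y; rewrite /= clamp_id//.
apply/andP; split; apply: ltW; near: y; [exact: lt_nbhsr|exact: lt_nbhsl].
Unshelve. all: by end_near. Qed.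

(** The extension is 0 to the left of 0, and the quotients from the right tend to 0, so the two
    sides match at 0. *)
Lemma is_derive_comp_clamp_le0 (T x : R) (f : R -> R) : 0 < T -> f 0 = 0 ->
  diff_quot f 0 y @[y --> within `[0, T] 0^'] --> (0 : R) -> x <= 0 ->
  is_derive x 1 (f \o clamp T) 0.
Proof.
move=> T0 f0 df; rewrite le_eqVlt => /orP[/eqP->|x0]; last first.
  apply: (@near_eq_is_derive _ _ _ (cst 0)).
  near=> y; rewrite /= clamp_le0 ?f0// ltW//.
  by near: y; exact: lt_nbhsl.
apply/is_derive_diff_quotP/cvgrPdist_le => e e0.
have h : \forall y \near 0^', `[0, T]%classic y -> `|0 - diff_quot f 0 y| <= e.
  by move/cvgrPdist_le : df => /(_ _ e0).
near=> y.
have [y0|y0] := leP y 0.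
  by rewrite /diff_quot/= !clamp_le0 ?lexx ?(ltW T0)// subrr mul0r subrr normr0 ltW.
have yT : y < T by near: y; apply: nbhs_dnbhs; exact: lt_nbhsl.
have yI : `[0, T]%classic y by rewrite /= in_itv/= !ltW.
rewrite /diff_quot/= (clamp_le0 (ltW T0) (lexx 0)) clamp_id; last by rewrite !ltW.
by move: yI; near: y.
Unshelve. all: by end_near. Qed.

Lemma within_continuous_powR (p T : R) : 0 < p -> 0 < T ->
  {within `[0, T], continuous (@powR R ^~ p)}.
Proof.
move=> p0 T0; apply/continuous_within_itvP => //; split.
- by move=> x; rewrite in_itv/= => /andP[x0 _]; exact: continuous_powR_gt0.
- by rewrite powR0 ?gt_eqF//; exact: powR_cvg0.
- by apply: cvg_at_left_filter; exact: continuous_powR_gt0.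
Qed.

(** With [M1 = M / (1 - g)], the derivative of [M1 * x]^ (1 - g)[is]M * x [^ (- g)]. So this power
    plus or minus [f] is nondecreasing on [0, T], which bounds increments of [f] by those of the
    power, that is, of [RLker (2 - g)]. *)
Lemma clamp_power_bound (T g M : R) (f h : R -> R) : 0 < T -> 0 < g < 1 -> 0 <= M ->
  {within `[0, T], continuous f} ->
  (forall x, 0 < x < T -> is_derive x 1 f (h x)) ->
  (forall x, 0 < x < T -> `|h x| <= M * x `^ (- g)) ->
  forall s t, s <= t ->
  `|f (clamp T t) - f (clamp T s)| <=
    M / (1 - g) * (RLker (2 - g) t - RLker (2 - g) s).
Proof.
move=> T0 /andP[g0 g1] M0 cf df hM.
have p0 : 0 < 1 - g by rewrite subr_gt0.
pose M1 := M / (1 - g); pose phi := @powR R ^~ (1 - g).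
have M10 : 0 <= M1 by rewrite divr_ge0// ltW.
have cphi := within_continuous_powR p0 T0.
have dphi (x : R) : 0 < x -> is_derive x 1 (M1 \*: phi) (M * x `^ (- g)).
  move=> x0; have := is_deriveZ M1 (@is_derive1_powR R (1 - g) x x0).
  rewrite (_ : 1 - g - 1 = - g); last by rewrite addrAC subrr sub0r.
  by rewrite /GRing.scale/= mulrA divfK// gt_eqF.
have mono (k : R -> R) (dk : R -> R) : {within `[0, T], continuous k} ->
    (forall x, 0 < x < T -> is_derive x 1 k (dk x)) ->
    (forall x, 0 < x < T -> 0 <= dk x) ->
    forall s t : R, 0 <= s -> s <= t -> t <= T -> k s <= k t.
  move=> ck dkk dk0 s t s0 st tT.
  apply: (@ger0_derive1_le_cc R k 0 T) => //.
  - by move=> x; rewrite in_itv/= => /dkk[].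
  - by move=> x; rewrite in_itv/= => xT; rewrite derive1E; have [_ ->] := dkk _ xT; exact: dk0.
  - by rewrite in_itv/= s0 (le_trans st).
  - by rewrite in_itv/= tT (le_trans s0).
have cM1 : {within `[0, T], continuous (M1 \*: phi)}.
  by move=> x; apply: cvgZr; exact: cphi.
have up (s t : R) : 0 <= s -> s <= t -> t <= T -> (M1 \*: phi - f) s <= (M1 \*: phi - f) t.
  apply: (mono _ (fun x => M * x `^ (- g) - h x)).
  - by move=> x; apply: cvgB; [exact: cM1|exact: cf].
  - by move=> x xT; apply: is_deriveB; [apply: dphi; case/andP : xT|exact: df].
  - by move=> x xT; rewrite subr_ge0 (le_trans (ler_norm _))// hM.
have dn (s t : R) : 0 <= s -> s <= t -> t <= T -> (M1 \*: phi + f) s <= (M1 \*: phi + f) t.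
  apply: (mono _ (fun x => M * x `^ (- g) + h x)).
  - by move=> x; apply: cvgD; [exact: cM1|exact: cf].
  - by move=> x xT; apply: is_deriveD; [apply: dphi; case/andP : xT|exact: df].
  - move=> x xT; rewrite -[h x]opprK subr_ge0 (le_trans (ler_norm _))// normrN hM//.
have phiE (x : R) : 0 <= x -> phi x = RLker (2 - g) x.
  rewrite le_eqVlt => /orP[/eqP<-|x0].
    by rewrite RLker_le0// /phi powR0// gt_eqF.
  by rewrite RLker_gt0// /phi; congr (_ `^ _); ring.
have kmono (x y : R) : x <= y -> RLker (2 - g) x <= RLker (2 - g) y.
  move=> xy; have [x0|x0] := leP x 0; first by rewrite RLker_le0// RLker_ge0.
  rewrite !RLker_gt0 ?(lt_le_trans x0)//; apply: ge0_ler_powR => //.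
  - by lra.
  - by rewrite nnegrE ltW.
  - by rewrite nnegrE (le_trans _ xy)// ltW.
move=> s t st.
have cst' : clamp T s <= clamp T t.
  by rewrite /clamp le_min !ge_min !ge_max !le_max st !lexx !orbT.
have /andP[s0 sT] := clampP s (ltW T0); have /andP[t0 tT] := clampP t (ltW T0).
have h1 : M1 * phi (clamp T s) - f (clamp T s) <= M1 * phi (clamp T t) - f (clamp T t).
  exact: up.
have h2 : M1 * phi (clamp T s) + f (clamp T s) <= M1 * phi (clamp T t) + f (clamp T t).
  exact: dn.
apply: (@le_trans _ _ (M1 * (RLker (2 - g) (clamp T t) - RLker (2 - g) (clamp T s)))).
  rewrite -!phiE// mulrBr ler_norml; apply/andP; split; lra.
(* Clamping can only shrink an increment of the nondecreasing kernel. *)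
rewrite ler_wpM2l//.
have [sT'|Ts] := leP s T.
  rewrite lerB//.
    have [t0'|t0'] := leP t 0; first by rewrite clamp_le0 ?(ltW T0)// RLker_le0// RLker_ge0.
    by apply: kmono; rewrite /clamp max_l ?(ltW t0')// ge_min lexx.
  have [s0'|s0'] := leP s 0; first by rewrite clamp_le0 ?(ltW T0)// !RLker_le0.
  by rewrite clamp_id// sT' ltW.
rewrite /clamp !max_l ?(ltW (lt_trans T0 Ts))// ?min_r ?(ltW Ts)//.
- by rewrite subrr subr_ge0 kmono.
- by rewrite (le_trans (ltW Ts)).
- by rewrite (le_trans _ st)// ltW// (lt_trans T0).
Qed.

End clamped_derivatives.

(** * The functions t^j / j! and their Taylor remainders *)

Section monomials.
Context {R : realType}.

(* The k-th derivative of t^j / j!. *)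
Definition dmonom (j k : nat) (x : R) : R :=
  if (k <= j)%N then x ^+ (j - k) / ((j - k)`!)%:R else 0.

Lemma is_derive_dmonom (j k : nat) (x : R) :
  is_derive x 1 (dmonom j k) (dmonom j k.+1 x).
Proof.
rewrite /dmonom; case: (ltngtP k j) => [kj|jk|->].
- rewrite subnS -[(j - k)%N]prednK ?subn_gt0//=; set i := (j - k).-1.
  have -> : (fun x : R => x ^+ i.+1 / (i.+1)`!%:R) = ((i.+1)`!%:R^-1 \*: (@GRing.exp R ^~ i.+1)).
    by apply/funext => y; rewrite /GRing.scale/= mulrC.
  have -> : x ^+ i / i`!%:R = (i.+1)`!%:R^-1 *: (i.+1%:R *: x ^+ i) :> R.
    rewrite /GRing.scale/= factS natrM; field.
    by rewrite pnatr_eq0 -lt0n fact_gt0 nat1r pnatr_eq0.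
  apply: is_deriveZ; have := is_deriveX i.+1 (is_derive_id x 1).
  rewrite {1}/GRing.scale/= mulr1 (_ : id ^+ i.+1 = @GRing.exp R ^~ i.+1)//.
  by apply/funext => y; rewrite fctE.
- exact: (@is_derive_cst R R R 0 x 1).
- by rewrite subnn; exact: (@is_derive_cst R R R (1 / 0`!%:R) x 1).
Qed.

Lemma continuous_dmonom (j k : nat) : continuous (dmonom j k).
Proof.
move=> x; apply/differentiable_continuous/derivable1_diffP.
by have [] := is_derive_dmonom j k x.
Qed.

Lemma dmonom_at0 (j k : nat) : dmonom j k 0 = (k == j)%:R.
Proof.
rewrite /dmonom; case: (ltngtP k j) => [kj|//|->].
  by rewrite expr0n subn_eq0 leqNgt kj mul0r.
by rewrite subnn expr0 fact0 divr1.
Qed.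

Lemma derivn_in_monom (T x : R) (j k : nat) : 0 < T -> 0 <= x <= T ->
  derivn_in `[0, T] k (fun t => t ^+ j / j`!%:R) x = dmonom j k x.
Proof.
move=> T0; elim: k x => [|k ih] x xT; first by rewrite /dmonom subn0.
apply: cvg_diff_quot_derive_in => //.
exact: (is_derive_in T0 xT ih (is_derive_dmonom j k x)).
Qed.

Lemma Cgamman_monom (T g : R) (n j : nat) : 0 < T -> (j < n)%N ->
  Cgamman T g n (fun t => t ^+ j / j`!%:R).
Proof.
move=> T0 jn; split.
- move=> k _ x xT; apply/cvg_ex; exists (dmonom j k.+1 x).
  apply: (is_derive_in T0 xT _ (is_derive_dmonom j k x)) => y.
  exact: derivn_in_monom.
- move=> k _; apply: (@subspace_eq_continuous _ _ _ (dmonom j k)).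
    by move=> x; rewrite inE/= in_itv/= => xT; rewrite /from_subspace derivn_in_monom.
  exact/continuous_subspaceT/continuous_dmonom.
- move=> k _ x /andP[x0 xT]; apply/cvg_ex; exists (dmonom j k.+1 x).
  have xT' : 0 <= x <= T by rewrite (ltW x0).
  apply: (is_derive_in T0 xT' _ (is_derive_dmonom j k x)) => y.
  exact: derivn_in_monom.
- exists (cst 0); split; first by apply: continuous_subspaceT; exact: cst_continuous.
  move=> t /andP[t0 tT]; rewrite derivn_in_monom ?(ltW t0)//.
  by rewrite /dmonom leqNgt jn mulr0.
Qed.

(** Canonical initial values leave a single term in the Taylor polynomial. For t^j / j! itself the
    remainder is therefore zero, which gives existence. *)
Lemma sub_taylorE (T : R) (n j : nat) (y : R -> R) (t : R) : (j < n)%N ->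
  (forall k, (k < n)%N -> derivn_in `[0, T] k y 0 = (k == j)%:R) ->
  sub_taylor T n y t = y t - t ^+ j / j`!%:R.
Proof.
move=> jn yj; rewrite /sub_taylor (bigD1 (Ordinal jn))//= yj// eqxx big1 ?addr0.
  by rewrite mulrC mul1r.
move=> i; rewrite -val_eqE/= => /negbTE ij.
by rewrite yj// ij !mul0r.
Qed.

Lemma derive1n_cst0 (k : nat) : ((cst 0 : R -> R)^`(k) = cst 0)%classic.
Proof.
elim: k => // k ih; rewrite derive1nS ih.
by apply/funext => x; rewrite derive1_cst.
Qed.

Lemma RLint0 (b : R) : RLint b (cst 0) = cst 0.
Proof.
apply/funext => t; rewrite /RLint; case: ifP => // _.
under eq_Rintegral do rewrite mulr0.
by rewrite Rintegral_cst// mul0r mulr0.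
Qed.

End monomials.

(** * Uniqueness of a solution with canonical initial values *)

Section caputo_uniqueness.
Context {R : realType}.

(** Here [n] is n0 - 1. The difference of [y] and t^j / j! has zero initial data; its derivatives,
    extended by [clamp], meet the hypotheses of [caputo_homogeneous_unique]. *)
Lemma caputo_solution_unique (T g : R) (m n j : nat) (alpha : nat -> R)
    (a : nat -> R -> R) (y : R -> R) : 0 < T -> (j <= n)%N ->
  g = n.+1%:R - alpha 0%N -> 0 < g < 1 ->
  (forall i, (1 <= i <= m)%N -> Cgamman T g 1 (a i)) ->
  (forall i, (1 <= i <= m)%N -> n%:R < alpha i < alpha 0%N) ->
  Cgamman T g n.+1 y -> is_solution T m alpha a y ->
  (forall k, (k <= n)%N ->
    derivn_in `[0, T] k y t @[t --> 0^'+] --> ((k == j)%:R : R)) ->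
  forall t, 0 <= t <= T -> y t = t ^+ j / (j`!)%:R.
Proof.
move=> T0 jn gE g01 aC alphaP [y1 y2 y3 y4] [ys ye] yc.
have [g0 g1] := andP g01.
(* The initial conditions are right limits; continuity on the closed interval makes them values at
   0, as used by [sub_taylor]. *)
have y0 k : (k <= n)%N -> derivn_in `[0, T] k y 0 = (k == j)%:R.
  move=> kn; have /continuous_within_itvP : {within `[0, T], continuous (derivn_in `[0, T] k y)}.
    exact: y2.
  by move=> /(_ T0)[_ cr _]; exact: cvg_unique cr (yc _ kn).
pose d k x := derivn_in `[0, T] k y x - dmonom j k x.
have d0 k : (k <= n)%N -> d k 0 = 0 by move=> kn; rewrite /d y0// dmonom_at0 subrr.
have cd k : (k <= n)%N -> {within `[0, T], continuous (d k)}.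
  move=> kn x; apply: cvgB; first exact: y2.
  exact: (continuous_subspaceT (@continuous_dmonom R j k)).
have dd k x : 0 <= x <= T -> derivable_in `[0, T] (derivn_in `[0, T] k y) x ->
    diff_quot (d k) x z @[z --> within `[0, T] x^'] --> d k.+1 x.
  move=> xT dk; have FF := within_dnbhs_proper T0 xT.
  have c1 := derivable_in_cvg dk.
  have c2 := is_derive_in T0 xT (fun _ _ => erefl) (is_derive_dmonom j k x).
  have c3 : diff_quot (derivn_in `[0, T] k y) x z - diff_quot (dmonom j k) x z
      @[z --> within `[0, T] x^'] --> d k.+1 x by exact: cvgB.
  apply: cvg_trans c3; apply: near_eq_cvg; apply: nearW => z.
  by rewrite /diff_quot /d -mulrBl; congr (_ / _); ring.
pose D k := d k \o clamp T.
have cD k : (k <= n)%N -> continuous (D k).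
  by move=> kn; apply: continuous_comp_clamp; [exact: ltW|exact: cd].
have D0 k : (k <= n)%N -> causal (D k).
  by move=> kn x x0; rewrite /D/= clamp_le0 ?(ltW T0)// d0.
have dD k : (k < n)%N -> forall x, x < T -> is_derive x 1 (D k) (D k.+1 x).
  move=> kn x xT; have dk z : 0 <= z <= T -> derivable_in `[0, T] (derivn_in `[0, T] k y) z.
    by apply: y1.
  (* At 0 the extension is differentiable because [d k.+1 0 = 0], available since [k.+1 <= n]. *)
  have [x0|x0] := leP x 0.
    rewrite (D0 _ kn _ x0); apply: is_derive_comp_clamp_le0 => //.
      by apply: d0; exact: ltnW.
    have T00 : 0 <= (0 : R) <= T by rewrite lexx ltW.
    by rewrite -[X in _ --> X](d0 _ kn); apply: dd => //; exact: dk.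
  have x0T : 0 <= x <= T by rewrite !ltW.
  rewrite /D/= [clamp T x]clamp_id//; apply: is_derive_comp_clamp; first by rewrite x0.
  by apply: dd => //; exact: dk.
(* The continuous function t^g times the top derivative is bounded, and t^j / j! contributes 0 at
   order [n.+1] because [j <= n]. *)
have [M M0 hM] : exists2 M, 0 <= M & forall x, 0 < x <= T -> `|d n.+1 x| <= M * x `^ (- g).
  have [h [ch hE]] := y4; have [M M0 hM] := continuous_itv_bounded ch.
  exists M => // x /andP[x0 xT].
  have -> : d n.+1 x = h x * x `^ (- g).
    rewrite hE ?x0// /d /dmonom ltnNge jn/= subr0 mulrAC -powRD ?subrr ?powRr0 ?mul1r//.
    by rewrite (gt_eqF x0) implybT.
  by rewrite normrM (ger0_norm (powR_ge0 _ _)) ler_wpM2r ?powR_ge0// hM// (ltW x0).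
have DM s t : s <= t -> `|D n t - D n s| <= M / (1 - g) * (RLker (2 - g) t - RLker (2 - g) s).
  apply: (@clamp_power_bound R T g M (d n) (d n.+1)) => //; first exact: cd.
    move=> x xT; have [x0 xT'] := andP xT.
    by apply: (diff_quot_itv_is_derive xT); apply: dd; [rewrite !ltW|apply: y3; rewrite ?x0 ?ltW].
  by move=> x /andP[x0 xT]; rewrite hM// x0 ltW.
have sE t : sub_taylor T n.+1 y t = y t - t ^+ j / j`!%:R by apply: sub_taylorE.
have uD t : 0 < t < T -> sub_taylor T n.+1 y t = D 0%N t.
  move=> /andP[t0 tT]; rewrite sE /D/= clamp_id ?(ltW t0) ?(ltW tT)//.
  by rewrite /d /dmonom subn0.
have oE i : (i <= m)%N -> order_of (alpha i) = n.+1.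
  case: i => [_|i im]; apply: order_ofE; rewrite -natr1 addrK.
    by move: gE; rewrite -natr1 => gE; apply/andP; split; lra.
  have /andP[h1 h2] := alphaP i.+1 im.
  by rewrite h1/=; move: gE; rewrite -natr1 => gE; lra.
pose beta i := n.+1%:R - alpha i.
have b0 : beta 0%N = g by rewrite gE.
have betaP i : (1 <= i <= m)%N -> beta 0%N < beta i < 1.
  move=> im; have /andP[h1 h2] := alphaP i im.
  by rewrite /beta -natr1; apply/andP; split; lra.
have aK i : (1 <= i <= m)%N -> exists2 K, 0 <= K & forall t, 0 < t < T -> `|a i t| <= K.
  move=> im; have [_ /(_ 0%N erefl) ca _ _] := aC i im.
  (* Membership in C^1_gamma includes continuity of the coefficient itself on [0, T]. *)
  have [K K0 aK] := continuous_itv_bounded ca; exists K => // t /andP[t0 tT].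
  by apply: aK; rewrite !ltW.
have dR i : (i <= m)%N -> forall t, 0 < t < T ->
    derivable ((RLint (beta i) (sub_taylor T n.+1 y))^`(n)%classic) t 1.
  move=> im t tT; have := ys i im; rewrite /caputo_derivable /RLderivable oE//.
  by move=> /(_ n (ltnSn n) t tT).
have eqR t : 0 < t < T -> (RLint (beta 0%N) (sub_taylor T n.+1 y))^`(n.+1)%classic t =
    - \sum_(1 <= i < m.+1) a i t * (RLint (beta i) (sub_taylor T n.+1 y))^`(n.+1)%classic t.
  move=> tT; have := ye t tT; rewrite /caputo /RLderiv oE// => ->.
  by congr (- _); apply: eq_big_nat => i /andP[_ im]; rewrite oE.
have M10 : 0 <= M / (1 - g) by rewrite divr_ge0// subr_ge0 ltW.
rewrite -b0 in g01 DM M10.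
have DE x : x < T -> D 0%N x = 0.
  exact: (caputo_homogeneous_unique cD D0 dD uD M10 g01 DM betaP aK dR eqR).
(* The equation only reaches points below [T]; the endpoint follows by continuity. *)
have DT : D 0%N T = 0.
  have c1 : D 0%N x @[x --> T^'-] --> D 0%N T by apply: cvg_at_left_filter; exact: cD.
  have c2 : D 0%N x @[x --> T^'-] --> (0 : R).
    apply: cvg_near_cst; near=> x; apply: DE; near: x; exact: nbhs_left_lt.
  exact: cvg_unique c1 c2.
move=> t /andP[t0 tT].
have : D 0%N t = 0 by move: tT; rewrite le_eqVlt => /orP[/eqP->//|]; exact: DE.
rewrite /D/= clamp_id ?t0// /d /dmonom subn0 => /eqP; rewrite subr_eq0.
by move=> /eqP.
Unshelve. all: by end_near. Qed.

End caputo_uniqueness.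

(** * Existence and uniqueness of the canonical fundamental system *)

Theorem theorem5 (R : realType) (T : R) (m n0 : nat) (alpha : nat -> R)
    (gamma : R) (a : nat -> R -> R)
    (T_gt0 : 0 < T)
    (m_ge1 : (1 <= m)%N)
    (alpha_decr : forall i : nat, (i < m)%N -> alpha i.+1 < alpha i)
    (alpha_ge0 : 0 <= alpha m)
    (n0_alpha0 : n0%:R - 1 < alpha 0%N <= n0%:R)
    (gammaE : gamma = n0%:R - alpha 0%N)
    (gamma01 : 0 < gamma < 1)
    (a_C1 : forall i : nat, (1 <= i <= m)%N -> Cgamman T gamma 1 (a i))
    (H_empty : Hset m alpha (n0%:R - 1) = set0) :
  [/\ forall j : 'I_n0, Cgamman T gamma n0 (fun t : R => t ^+ j / (j`!)%:R),
      canonical_fundamental_system T m alpha a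
        (fun (j : 'I_n0) (t : R) => t ^+ j / (j`!)%:R)
    & forall y : 'I_n0 -> R -> R,
        (forall j : 'I_n0, Cgamman T gamma n0 (y j)) ->
        canonical_fundamental_system T m alpha a y ->
        forall (j : 'I_n0) (t : R), 0 <= t <= T -> y j t = t ^+ j / (j`!)%:R].
Proof.
have alpha_mono i k : (i < k <= m)%N -> alpha k < alpha i.
  elim: k => // k ih /andP[ik km].
  have [->|ik'] := eqVneq i k; first exact: alpha_decr.
  apply: lt_trans (alpha_decr _ km) (ih _).
  by rewrite ltn_neqAle ik' -ltnS ik ltnW.
have alpha0 i : (i <= m)%N -> 0 <= alpha i.
  rewrite leq_eqVlt => /orP[/eqP->//|im].
  by rewrite ltW// (le_lt_trans alpha_ge0)// alpha_mono// im leqnn.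
(* An index with [alpha i <= n0 - 1] would belong to the empty set [Hset]. *)
have alphaP i : (1 <= i <= m)%N -> n0%:R - 1 < alpha i < alpha 0%N.
  move=> im; have [i1 im'] := andP im; rewrite alpha_mono// andbT ltNge; apply/negP => h.
  have : Hset m alpha (n0%:R - 1) i by split=> //; rewrite alpha0.
  by rewrite H_empty.
have oE i : (i <= m)%N -> order_of (alpha i) = n0.
  case: i => [_|i im]; apply: order_ofE => //.
  have /andP[-> h]/= := alphaP i.+1 im.
  by rewrite (le_trans (ltW h))//; case/andP : n0_alpha0.
split.
- by move=> j; exact: Cgamman_monom.
(* The monomial is its own Taylor polynomial, so every Caputo derivative in the equation is that of
   the zero function. *)
- have zeroE (j : 'I_n0) : sub_taylor T n0 (fun t : R => t ^+ j / (j`!)%:R) = cst 0.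
    apply/funext => t; rewrite (@sub_taylorE _ _ _ j)// ?subrr// => k _.
    by rewrite derivn_in_monom ?lexx ?ltW// dmonom_at0.
  split=> [j|k j].
    split=> [i im|t tT].
      rewrite /caputo_derivable /RLderivable oE// zeroE RLint0 => k _ t _.
      by rewrite derive1n_cst0; exact: derivable_cst.
    rewrite /caputo /RLderiv oE// zeroE RLint0 derive1n_cst0.
    rewrite big_nat_cond big1 ?oppr0// => i; rewrite andbT => /andP[_ im].
    by rewrite oE// zeroE RLint0 derive1n_cst0 mulr0.
  have c : dmonom j k t @[t --> 0^'+] --> ((k == j)%:R : R).
    rewrite -val_eqE/= -(@dmonom_at0 R); apply: cvg_at_right_filter.
    exact: continuous_dmonom.
  apply: cvg_trans c; apply: near_eq_cvg; near=> t.
  rewrite derivn_in_monom//; apply/andP; split; apply: ltW; near: t.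
    exact: nbhs_right_gt.
  exact: nbhs_right_lt.
- move=> y yC [ys yc] j.
  (* The index [j] itself witnesses that [n0] is positive. *)
  have n0E : n0 = n0.-1.+1 by rewrite prednK// (leq_ltn_trans _ (ltn_ord j)).
  have jn : (j <= n0.-1)%N by rewrite -ltnS -n0E.
  apply: (@caputo_solution_unique R T gamma m n0.-1 j alpha a (y j)) => //.
  + by rewrite -n0E.
  + by move=> i im; have := alphaP i im; rewrite [X in X%:R - 1]n0E -natr1 addrK.
  + by rewrite -n0E.
  + move=> k kn; have kn0 : (k < n0)%N by rewrite n0E ltnS.
    by have := yc (Ordinal kn0) j; rewrite -val_eqE.
Unshelve. all: by end_near. Qed.
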